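(* Let $k\in\mathbb{N}$ and let $W:[0,1]^2\to[0,1)$ be a $k$-block graphon. Let $\boldsymbol{G}\sim\mathcal{G}(n,W)$. Then, with high probability as $n\to\infty$, $$\chi(\boldsymbol{G})=(\varphi_k(W)+o(1))\frac{n}{2\log n};$$ that is, for every fixed $\epsilon>0$, $\mathbb{P}\big(\big|\chi(\boldsymbol{G})\frac{2\log n}{n}-\varphi_k(W)\big|\le\epsilon\big)\to1$ as $n\to\infty$.
   Context: A graphon is a symmetric measurable function $W:[0,1]^2\to[0,1]$. It is a $k$-block graphon if $W\equiv\sum_{i,j\in[k]}p_{ij}\mathbf{1}_{S_i\times S_j}$ where $p_{ij}\in[0,1]$, $(S_i)_{i\in[k]}$ is a partition of $[0,1]$ into measurable sets, and $\mathbf{1}_{A}$ is the indicator function of $A$. The random graph $\mathcal{G}(n,W)$ has vertex set $[n]=\{1,\dots,n\}$: sample $X_1,\dots,X_n$ independently and uniformly from $[0,1]$; conditionally on these, each edge $ij$ ($i\ne j$) is present independently with probability $W(X_i,X_j)$. $\chi(G)$ is the chromatic number, $\log$ is the natural logarithm, $\lambda$ is the Lebesgue (uniform) measure on $[0,1]$, and $\mathcal{P}([0,1])$ is the set of probability measures on $[0,1]$. $\mathcal{C}_\lambda$ is the set of pairs $(\mathcal{M},\boldsymbol{\alpha})$ where $\mathcal{M}\subset\mathcal{P}([0,1])$ is finite and $\boldsymbol{\alpha}=(\alpha_\mu)_{\mu\in\mathcal{M}}\in[0,1]^{|\mathcal{M}|}$ satisfies $\sum_{\mu\in\mathcal{M}}\alpha_\mu=1$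 and $\sum_{\mu\in\mathcal{M}}\alpha_\mu\mu=\lambda$. For $\mu\in\mathcal{P}([0,1])$, $$\varphi(\mu,W):=\sup_{S\subseteq[0,1]:\ \mu(S)>0}\frac1{\mu(S)}\int_S\int_S\log\Big(\frac1{1-W(x,y)}\Big)\,d\mu(x)\,d\mu(y)$$ (supremum over measurable $S$), and $$\varphi_k(W):=\inf_{(\mathcal{M},\boldsymbol{\alpha})\in\mathcal{C}_\lambda,\ |\mathcal{M}|\le k}\ \sum_{\mu\in\mathcal{M}}\alpha_\mu\varphi(\mu,W).$$ *)

(* Defs.v *)
From HB Require Import structures.
From mathcomp Require Import all_boot all_order all_algebra.
From mathcomp Require Import all_classical all_reals all_analysis.

Set Implicit Arguments.
Unset Strict Implicit.
Unset Printing Implicit Defensive.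

Import Order.TTheory GRing.Theory Num.Theory.
Import numFieldNormedType.Exports.

Local Open Scope classical_set_scope.
Local Open Scope ring_scope.

Record simple_graph (V : finType) := SimpleGraph {
  adj :> rel V;
  adj_sym : symmetric adj;
  adj_irr : irreflexive adj }.

Definition colorable (V : finType) (G : simple_graph V) (m : nat) : bool :=
  [exists c : {ffun V -> 'I_m}, [forall x, forall y, adj G x y ==> (c x != c y)]].

Lemma ex_colorable (V : finType) (G : simple_graph V) :
  exists m, colorable G m.
Proof.
exists #|V|; apply/existsP; exists [ffun x => enum_rank x].
apply/forallP => x; apply/forallP => y; apply/implyP => Gxy.
rewrite !ffunE; apply: contraTN Gxy => /eqP/enum_rank_inj ->.
by rewrite adj_irr.
Qed.

Definition chromatic_number (V : finType) (G : simple_graph V) : nat :=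
  ex_minn (ex_colorable G).

(* Functions on [0,1]^2 are represented by total functions on R * R of which
   only the values on [0,1]^2 matter. *)
Definition graphon (R : realType) (W : R -> R -> R) : Prop :=
  [/\ measurable_fun ((`[0, 1] : set R) `*` (`[0, 1] : set R))
        (fun z : R * R => W z.1 z.2),
      {in `[0, 1] &, forall x y, W x y = W y x} &
      {in `[0, 1] &, forall x y, 0 <= W x y <= 1}].

(* Parts of the partition are allowed to be empty; since [0,1] is infinite, this
   gives the same class of graphons as nonempty parts. *)
Definition block_graphon (R : realType) (k : nat) (W : R -> R -> R) : Prop :=
  graphon W /\
  exists (p : 'I_k -> 'I_k -> R) (S : 'I_k -> set R),
    [/\ forall i j, 0 <= p i j <= 1,
        forall i, measurable (S i),
        \bigcup_i S i = `[0, 1]%classic,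
        trivIset setT S &
        {in `[0, 1] &, forall x y,
          W x y = \sum_(i < k) \sum_(j < k) p i j * \1_(S i) x * \1_(S j) y}].

Definition unif01 (R : realType) : probability (measurableTypeR R) R :=
  uniform_prob (@ltr01 R).

Definition indep_uniform d (T : measurableType d) (R : realType)
    (P : probability T R) (n : nat) (X : 'I_n -> {RV P >-> R}) : Prop :=
  [/\ forall i w, X i w \in `[0, 1],
      forall i (A : set R), measurable A -> distribution P (X i) A = unif01 R A &
      forall A : 'I_n -> set R, (forall i, measurable (A i)) ->
        P (\bigcap_i (X i @^-1` A i)) = (\prod_(i < n) P (X i @^-1` A i))%E].

(* G has law G(n,W): the second component is the defining property of the
   conditional probability P(G = H | X_1,...,X_n), namely that it equals the
   product of W(X_i,X_j) over the edges of H and of 1 - W(X_i,X_j) over the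
   non-edges, tested on every event A of the sigma-algebra generated by X. *)
Definition graphon_random_graph d (T : measurableType d) (R : realType)
    (P : probability T R) (W : R -> R -> R) (n : nat)
    (G : T -> simple_graph 'I_n) : Prop :=
  (forall i j, measurable [set w | adj (G w) i j]) /\
  exists2 X : 'I_n -> {RV P >-> R}, indep_uniform X &
    forall (H : simple_graph 'I_n) (A : set T),
      g_sigma_preimage (fun i => X i : T -> R) A ->
      P (A `&` [set w | adj (G w) =2 adj H]) =
      (\int[P]_(w in A)
        (\prod_(i < n) \prod_(j < n | (i < j)%N)
          (if adj H i j then W (X i w) (X j w)
           else 1 - W (X i w) (X j w)))%:E)%E.

(* In \bar R, 0^-1 = +oo and lne +oo = +oo, so that log(1/(1-W)) is +oo
   where W = 1. *)
Definition varphi (R : realType) (mu : probability (measurableTypeR R) R) (W : R -> R -> R) :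
    \bar R :=
  ereal_sup [set ((mu S)^-1 *
      \int[mu]_(y in S) \int[mu]_(x in S) lne ((1 - W x y)%:E^-1))%E
    | S in [set S : set R | [/\ measurable S, S `<=` `[0, 1] & (0 < mu S)%E]]].

(* Probability measures on [0,1] are Borel probability measures mu on R with
   mu [0,1] = 1. *)
Definition decomposition (R : realType) (M : set (probability (measurableTypeR R) R))
    (alpha : probability (measurableTypeR R) R -> R) : Prop :=
  [/\ finite_set M /\ forall mu, M mu -> mu (`[0, 1]%classic : set R) = 1%E,
      forall mu, M mu -> 0 <= alpha mu <= 1,
      \sum_(mu \in M) alpha mu = 1 &
      forall A : set R, measurable A ->
        (\sum_(mu \in M) (alpha mu)%:E * mu A)%E = unif01 R A].

Definition varphi_k (R : realType) (k : nat) (W : R -> R -> R) : \bar R :=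
  ereal_inf [set x | exists M alpha,
    [/\ decomposition M alpha, (M #<= `I_k)%card &
        x = (\sum_(mu \in M) (alpha mu)%:E * varphi mu W)%E]].

(* Main.v *)
Require Import Defs.
From HB Require Import structures.
From mathcomp Require Import all_boot all_order all_algebra.
From mathcomp Require Import ring lra.

(** Let [S_1, ..., S_k] be the blocks of [W], of sizes [s_i], and put
    [a_ij = log (1 / (1 - W))] on [S_i * S_j].  Convexity in each coordinate shows
    that only unions of blocks matter in the supremum defining [varphi mu W], so
    that [varphi mu W <= c] means that the vector [x] of block masses of [mu] is
    [c]-sparse: [sum_(i, j in J) a_ij x_i x_j <= c sum_(i in J) x_i] for every set
    [J] of blocks.  Thus [varphi_k W] is the least total cost of a decomposition of
    [s] into at most [k] nonnegative vectors, and by conic Caratheodory the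
    restriction to [k] pieces is immaterial.

    Lower bound: a first moment over all vertex sets shows that whp every
    independent set has a [(2 + o(1)) log n]-sparse profile, so the colour classes of
    a proper colouring are a decomposition of [(1 - o(1)) n s].

    Upper bound: if [x] is [c]-sparse then the profile
    [q = (2 - o(1)) (log n / c) x] occurs in every vertex set that still has
    [n^(1 - o(1))] vertices of each type involved.  The second moment of the number
    of independent transversals of suitable cells, fed into Janson's inequality,
    makes the failure probability [exp (- n^(3/2 - o(1)))], which beats the [2^n]
    choices of the vertex set.  Removing such independent sets greedily, piece by
    piece of a near optimal decomposition, leaves [o(n / log n)] vertices. *)

Set Implicit Arguments.
Unset Strict Implicit.
Unset Printing Implicit Defensive.

Import Order.TTheory GRing.Theory Num.Theory.

Local Open Scope ring_scope.

(** * Product measures on edge configurations *)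

(** All estimates on the random graph are made for a fixed assignment of types, under an explicit
    product measure on finite edge configurations; [prob_conf] transfers them to the given
    probability spaces. With [l = ln n], the obstacle in the upper bound is the union bound over
    [2^n] vertex sets, since a second moment alone leaves a failure probability that is only
    polynomially small. Transversals of cells of equal size all have the same profile, hence the
    same probability [p] of being independent, and their overlaps are counted cell by cell. If
    [p^2 * rho] bounds the overlap term of an average pair, about [1 / (2 p rho)] transversals can
    be chosen so weakly correlated that each Janson step gains a factor [1 - p / 2]. The product is
    about [exp (- 1 / (4 rho))], from which [p] has disappeared. Transversals must share two
    vertices to share an edge, which costs about [n^-2]; the bound [rho <= e * n^(-3/2)] leaves room
    for cells slightly smaller than [n]. *)

Section ProductMeasure.
Variables (R : realFieldType) (E : finType) (pr : E -> R).
Hypothesis pr01 : forall e, 0 <= pr e <= 1.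
Implicit Types (w : {ffun E -> bool}) (f g : {ffun E -> bool} -> R).
Implicit Types (T : {set E}).

Definition conf_weight w : R := \prod_e (if w e then pr e else 1 - pr e).
Definition Ex f : R := \sum_w conf_weight w * f w.
Definition upd w e b : {ffun E -> bool} :=
  [ffun e' => if e' == e then b else w e'].
(** The conditional expectation of [f] given all coordinates other than [e]. *)
Definition avg e f w : R :=
  pr e * f (upd w e true) + (1 - pr e) * f (upd w e false).

Lemma conf_weight_ge0 w : 0 <= conf_weight w.
Proof.
by apply: prodr_ge0 => e _; have /andP[? ?] := pr01 e; case: ifP; rewrite ?subr_ge0.
Qed.

Lemma Ex_ge0 f : (forall w, 0 <= f w) -> 0 <= Ex f.
Proof. by move=> f0; apply: sumr_ge0 => w _; rewrite mulr_ge0 ?conf_weight_ge0. Qed.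

Lemma ler_Ex f g : (forall w, f w <= g w) -> Ex f <= Ex g.
Proof. by move=> fg; apply: ler_sum => w _; rewrite ler_wpM2l ?conf_weight_ge0. Qed.

Lemma eq_Ex f g : f =1 g -> Ex f = Ex g.
Proof. by move=> fg; apply: eq_bigr => w _; rewrite fg. Qed.

Lemma ExB f g : Ex (fun w => f w - g w) = Ex f - Ex g.
Proof. by rewrite /Ex -sumrB; apply: eq_bigr => w _; rewrite mulrBr. Qed.

Lemma Ex_sum (I : Type) (r : seq I) (P : pred I) (F : I -> {ffun E -> bool} -> R) :
  Ex (fun w => \sum_(i <- r | P i) F i w) = \sum_(i <- r | P i) Ex (F i).
Proof.
rewrite /Ex exchange_big /=; apply: eq_bigr => w _.
by rewrite mulr_sumr.
Qed.

Lemma Ex_cst c : Ex (fun=> c) = c.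
Proof.
rewrite /Ex -mulr_suml /conf_weight.
rewrite -(bigA_distr_bigA (fun e (b : bool) => if b then pr e else 1 - pr e)) /=.
rewrite big1 ?mul1r// => e _.
by rewrite (bigD1 true)//= (bigD1 false)//= big1 => [|[]//]; ring.
Qed.

Lemma upd_id w e : upd w e (w e) = w.
Proof. by apply/ffunP => x; rewrite ffunE; case: eqP => [->|]. Qed.

Lemma upd_upd w e b c : upd (upd w e b) e c = upd w e c.
Proof. by apply/ffunP => x; rewrite !ffunE; case: eqP. Qed.

Lemma updE w e b : upd w e b e = b.
Proof. by rewrite ffunE eqxx. Qed.

Lemma Ex_avg e f : Ex (avg e f) = Ex f.
Proof.
(* Configurations are paired by flipping the value at [e]; [T] keeps the member of each pair with
   [e] on and weighs it by the other coordinates alone. *)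
pose T (g : {ffun E -> bool} -> R) := \sum_(w : {ffun E -> bool} | w e)
  (\prod_(e' | e' != e) (if w e' then pr e' else 1 - pr e')) * g w.
have ExT g : Ex g = T (avg e g).
  rewrite /Ex (bigID (fun w : {ffun E -> bool} => w e)) /=.
  rewrite [X in _ + X](reindex_onto (fun w => upd w e false)
    (fun w => upd w e true)) /=; last first.
    by move=> w /negbTE <-; rewrite upd_upd upd_id.
  have PE w : ~~ upd w e false e && (upd (upd w e false) e true == w) = w e.
    rewrite updE upd_upd /=; apply/eqP/idP => [<-|we]; first by rewrite updE.
    by rewrite -[in LHS]we upd_id.
  rewrite [X in _ + X](eq_bigl _ _ PE) -big_split; apply: eq_bigr => w we /=.
  rewrite /conf_weight (bigD1 e)//= we [X in _ + X * _](bigD1 e)//= updE.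
  rewrite [X in _ + _ * X * _](eq_bigr (fun e' => if w e' then pr e' else 1 - pr e')).
    by rewrite /avg -[in upd w e true]we upd_id; ring.
  by move=> e' /negbTE e'e; rewrite ffunE e'e.
by rewrite !ExT; apply: eq_bigr => w _; congr (_ * _); rewrite /avg !upd_upd; ring.
Qed.

Definition avgs (l : seq E) f := foldr avg f l.

Lemma Ex_avgs l f : Ex (avgs l f) = Ex f.
Proof. by elim: l => //= e l IH; rewrite Ex_avg. Qed.

Lemma eq_avgs l f w w' :
  (forall e, e \notin l -> w e = w' e) -> avgs l f w = avgs l f w'.
Proof.
elim: l w w' => [|e l IH] w w' ww' /=.
  by congr f; apply/ffunP => e; apply: ww'.
by rewrite /avg; congr (_ * _ + _ * _); apply: IH => e' e'l; rewrite !ffunE;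
  case: eqP => // /eqP e'e; apply: ww'; rewrite inE negb_or e'e.
Qed.

(** Averaging over every coordinate leaves a constant function, so an expectation can be computed
    one coordinate at a time from any starting configuration. This turns Harris' inequality into an
    induction. *)
Lemma Ex_avgs_enum f w : Ex f = avgs (enum E) f w.
Proof.
rewrite -(Ex_avgs (enum E)) -[RHS]Ex_cst; apply: eq_Ex => w'.
by apply: eq_avgs => e; rewrite mem_enum.
Qed.

Definition le_conf w w' := forall e, w e -> w' e.
Definition increasing f := forall w w', le_conf w w' -> f w <= f w'.
Definition decreasing f := forall w w', le_conf w w' -> f w' <= f w.

Lemma le_conf_upd w w' e b : le_conf w w' -> le_conf (upd w e b) (upd w' e b).
Proof. by move=> ww' x; rewrite !ffunE; case: eqP => // _; apply: ww'. Qed.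

Lemma increasing_avgs l f : increasing f -> increasing (avgs l f).
Proof.
elim: l => //= e l IH fi w w' ww'; have /andP[p0 p1] := pr01 e.
by rewrite /avg lerD// ler_wpM2l ?subr_ge0 ?IH//; apply: le_conf_upd.
Qed.

Lemma decreasing_avgs l f : decreasing f -> decreasing (avgs l f).
Proof.
elim: l => //= e l IH fi w w' ww'; have /andP[p0 p1] := pr01 e.
by rewrite /avg lerD// ler_wpM2l ?subr_ge0 ?IH//; apply: le_conf_upd.
Qed.

(** The induction step is Chebyshev's inequality on two points: the defect is [pr e * (1 - pr e)]
    times the product of the two increments, whose signs are known because averaging preserves
    monotonicity. *)
Lemma avgs_harris l f g w : increasing f -> decreasing g ->
  avgs l (fun w => f w * g w) w <= avgs l f w * avgs l g w.
Proof.
move=> fi gd; elim: l w => //= e l IH w; have /andP[p0 p1] := pr01 e.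
set F := avgs l f; set G := avgs l g.
have le_ft : le_conf (upd w e false) (upd w e true).
  by move=> x; rewrite !ffunE; case: eqP.
have F01 : F (upd w e false) <= F (upd w e true) by apply: increasing_avgs.
have G01 : G (upd w e true) <= G (upd w e false) by apply: decreasing_avgs.
apply: (@le_trans _ _ (avg e (fun w => F w * G w) w)).
  by rewrite /avg lerD// ler_wpM2l ?subr_ge0.
have : 0 <= (pr e * (1 - pr e)) *
  ((F (upd w e true) - F (upd w e false)) * (G (upd w e false) - G (upd w e true))).
  by rewrite !mulr_ge0 ?subr_ge0.
by rewrite /avg; lra.
Qed.

Lemma harris f g : increasing f -> decreasing g ->
  Ex (fun w => f w * g w) <= Ex f * Ex g.
Proof.
move=> fi gd; pose w0 : {ffun E -> bool} := [ffun=> false].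
by rewrite !(Ex_avgs_enum _ w0) avgs_harris.
Qed.

Definition absent T w := [forall e in T, ~~ w e].
Definition switch_off T w : {ffun E -> bool} := [ffun e => (e \notin T) && w e].
Definition prob_absent T : R := \prod_(e in T) (1 - pr e).

Lemma prob_absent_ge0 T : 0 <= prob_absent T.
Proof. by apply: prodr_ge0 => e _; have /andP[] := pr01 e; rewrite subr_ge0. Qed.

Lemma Ex_absent1 e f :
  Ex (fun w => (~~ w e)%:R * f w) = (1 - pr e) * Ex (fun w => f (upd w e false)).
Proof.
rewrite -(Ex_avg e) /Ex mulr_sumr; apply: eq_bigr => w _.
by rewrite /avg !updE /=; ring.
Qed.

(** When [T] is absent, [w] and [switch_off T w] coincide, and the latter ignores the coordinates in
    [T], which are independent of the rest. Conditioning on absence thus becomes an expectation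
    under the original measure. *)
Lemma Ex_absent T f :
  Ex (fun w => (absent T w)%:R * f w) = prob_absent T * Ex (fun w => f (switch_off T w)).
Proof.
move: {2}#|T| (erefl #|T|) => m; elim: m T f => [|m IH] T f.
  move=> /eqP; rewrite cards_eq0 => /eqP ->; rewrite /prob_absent big_set0 mul1r.
  apply: eq_Ex => w; rewrite (_ : absent _ w); last first.
    by apply/forall_inP => e; rewrite inE.
  by rewrite mul1r; congr f; apply/ffunP => e; rewrite !ffunE inE.
move=> Tm; have [e eT] : exists e, e \in T by apply/set0Pn; rewrite -cards_eq0 Tm.
have T'm : #|T :\ e| = m by move: Tm; rewrite (cardsD1 e) eT => -[].
transitivity (Ex (fun w => (~~ w e)%:R * ((absent (T :\ e) w)%:R * f w))).
  apply: eq_Ex => w; rewrite mulrA -natrM mulnb; congr (_%:R * _).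
  congr (nat_of_bool _); apply/forall_inP/andP => [Tw|[we /forall_inP Tw] x xT].
    by split; [exact: Tw|apply/forall_inP => x /setD1P[_]; exact: Tw].
  by have [->//|xe] := eqVneq x e; apply: Tw; rewrite !inE xe.
rewrite Ex_absent1 (eq_Ex (g := fun w => (absent (T :\ e) w)%:R * f (upd w e false))).
  rewrite IH// mulrA /prob_absent [in RHS](big_setD1 e)//=; congr (_ * _).
  apply: eq_Ex => w; congr f; apply/ffunP => x; rewrite !ffunE !inE.
  by case: eqP => //= ->; rewrite eT.
move=> w; congr (_%:R * _); congr nat_of_bool; apply: eq_forallb => x.
by rewrite !ffunE !inE; case: eqP.
Qed.

Lemma Ex_absent_cst T : Ex (fun w => (absent T w)%:R) = prob_absent T.
Proof.
rewrite -[RHS]mulr1 -[X in _ = _ * X]Ex_cst -(Ex_absent T (fun=> 1)).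
by apply: eq_Ex => w; rewrite mulr1.
Qed.

Lemma prob_absentU T T' : prob_absent T * Ex (fun w => (absent T' (switch_off T w))%:R) = prob_absent (T :|: T').
Proof.
rewrite -(Ex_absent T (fun w => (absent T' w)%:R)) -Ex_absent_cst; apply: eq_Ex => w.
rewrite -natrM mulnb; congr (nat_of_bool _)%:R.
apply/andP/forall_inP => [[/forall_inP a /forall_inP b] x|a].
  by rewrite inE => /orP[]; [exact: a|exact: b].
by split; apply/forall_inP => x xT; apply: a; rewrite inE xT ?orbT.
Qed.

Variables (F : eqType) (T : F -> {set E}).
Definition none_absent (l : seq F) w := all (fun x => ~~ absent (T x) w) l.

Lemma increasing_none_absent l : increasing (fun w => (none_absent l w)%:R).
Proof.
move=> w w' ww'; rewrite ler_nat; case: (boolP (none_absent l w)) => //.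
move=> /allP h; suff -> : none_absent l w' by [].
apply/allP => x /h; apply: contra => /forall_inP a; apply/forall_inP => e /a.
by apply: contra; apply: ww'.
Qed.

(** Condition on [T x] being absent. The sets [T y] disjoint from [T x] are unaffected, and that
    none of them is absent is an increasing event; that an overlapping [T y] is absent once [T x] is
    off is a decreasing one. A union bound over the overlapping sets and Harris' inequality
    conclude. *)
Lemma janson_step x l :
  Ex (fun w => (none_absent (x :: l) w)%:R) <=
  Ex (fun w => (none_absent l w)%:R) *
  (1 - prob_absent (T x) + \sum_(y <- l | ~~ [disjoint T x & T y]) prob_absent (T x :|: T y)).
Proof.
set D := fun w => (none_absent l w)%:R; set S := \sum_(_ <- _ | _) _.
have -> : Ex (fun w => (none_absent (x :: l) w)%:R) =
    Ex D - prob_absent (T x) * Ex (fun w => D (switch_off (T x) w)).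
  rewrite -Ex_absent -ExB; apply: eq_Ex => w; rewrite /D /=.
  by case: absent => /=; rewrite ?mul1r ?subrr ?mul0r ?subr0.
suff : Ex D * (prob_absent (T x) - S) <= prob_absent (T x) * Ex (fun w => D (switch_off (T x) w)) by lra.
have ED0 : 0 <= Ex D by apply: Ex_ge0 => w; rewrite ler0n.
have [pS|pS] := leP 0 (prob_absent (T x) - S); last first.
  apply: (@le_trans _ _ 0); first by rewrite mulr_ge0_le0// ltW.
  by rewrite mulr_ge0 ?prob_absent_ge0// Ex_ge0// => w; rewrite ler0n.
pose l0 := [seq y <- l | [disjoint T x & T y]].
pose C w : R := (none_absent l0 w)%:R.
pose B y w : R := (absent (T y) (switch_off (T x) w))%:R.
have DC w : D w <= C w.
  rewrite ler_nat; case: (boolP (none_absent l w)) => // /allP h.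
  by rewrite (_ : none_absent l0 w)//; apply/allP => y; rewrite mem_filter => /andP[_ /h].
have Cinc : increasing C by exact: increasing_none_absent.
have Bdec y : decreasing (B y).
  move=> w w' ww'; rewrite ler_nat; case: (boolP (absent _ (switch_off _ w'))) => // /forall_inP h.
  rewrite (_ : absent _ _)//; apply/forall_inP => e /h; rewrite !ffunE.
  by apply: contra => /andP[-> /ww'].
have DcC w : C w - \sum_(y <- l | ~~ [disjoint T x & T y]) C w * B y w
    <= D (switch_off (T x) w).
  rewrite -mulr_sumr.
  have [Cw|Cw] := boolP (none_absent l0 w); last first.
    by rewrite /C (negbTE Cw) mul0r subr0 ler0n.
  rewrite /C Cw mul1r /D.
  have [_|/allPn[y yl]] := boolP (none_absent l _).
    rewrite gerBl sumr_ge0// => y _; by rewrite ler0n.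
  rewrite negbK => yabs; have [dxy|dxy] := boolP [disjoint T x & T y].
    move/allP: Cw => /(_ y); rewrite mem_filter dxy => /(_ yl) /negP[].
    apply/forall_inP => e ey; move/forall_inP: yabs => /(_ e ey).
    rewrite ffunE; suff -> : e \notin T x by [].
    by apply/negP => ex; move/pred0P: dxy => /(_ e) /=; rewrite ex ey.
  rewrite subr_le0 (big_rem y)//= dxy /B yabs lerDl sumr_ge0// => z _; exact: ler0n.
apply: (@le_trans _ _ (Ex C * (prob_absent (T x) - S))).
  by rewrite ler_wpM2r// ler_Ex.
rewrite mulrBr mulr_sumr mulrC.
apply: (@le_trans _ _ (prob_absent (T x) * (Ex C - \sum_(y <- l | ~~ [disjoint T x & T y])
    Ex C * Ex (B y)))).
  rewrite mulrBr lerD2l lerN2 mulr_sumr le_eqVlt; apply/orP; left; apply/eqP.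
  by apply: eq_bigr => y _; rewrite -prob_absentU; ring.
rewrite ler_wpM2l ?prob_absent_ge0//; apply: le_trans (ler_Ex DcC).
rewrite ExB Ex_sum lerB// ler_sum// => y _; exact: harris.
Qed.

End ProductMeasure.

(** * Independent transversals: overlaps and the Janson tail *)

Section Transversals.
Variables (R : realFieldType) (n : nat) (pr : 'I_n * 'I_n -> R).
Hypothesis pr01 : forall e, 0 <= pr e < 1.

Definition edges (S : {set 'I_n}) : {set 'I_n * 'I_n} :=
  [set e | [&& e.1 \in S, e.2 \in S & (e.1 < e.2)%N]].

Lemma edgesI S S' : edges S :&: edges S' = edges (S :&: S').
Proof.
by apply/setP => e; rewrite !inE; case: (e.1 \in S); case: (e.2 \in S);
  case: (e.1 < e.2)%N; rewrite ?(andbT, andbF).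
Qed.

Lemma edges_small (S : {set 'I_n}) : (#|S| < 2)%N -> edges S = set0.
Proof.
move=> S1; apply/setP => e; rewrite !inE; apply/negP => /and3P[e1 e2 e12].
have : (1 < #|S|)%N.
  by apply/card_gt1P; exists e.1, e.2; split=> //; rewrite -val_eqE /= neq_ltn e12.
by rewrite ltnNge -ltnS S1.
Qed.

Lemma prob_absent_gt0 T : 0 < prob_absent pr T.
Proof. by apply: prodr_gt0 => e _; have /andP[_] := pr01 e; rewrite subr_gt0. Qed.


Lemma prob_absentUI T T' : prob_absent pr (T :|: T') = prob_absent pr T * prob_absent pr T' / prob_absent pr (T :&: T').
Proof.
apply: (mulIf (lt0r_neq0 (prob_absent_gt0 (T :&: T')))).
rewrite mulfVK ?lt0r_neq0 ?prob_absent_gt0// /prob_absent (big_setID T)/= setUK.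
rewrite setDUl setDv set0U [in RHS]mulrC [X in _ = X * _](big_setID T)/=.
by rewrite (setIC T' T); ring.
Qed.

Variables (K : finType) (b : nat) (v : K -> 'I_b -> 'I_n).
Hypothesis b_gt0 : (0 < b)%N.
Hypothesis v_inj : forall c i c' i', v c i = v c' i' -> c = c' /\ i = i'.
Implicit Types f g : {ffun K -> 'I_b}.

(** The vertices [v c i] with [c] fixed form a cell of size [b]; [v_inj] makes the cells
    disjoint. *)
Definition transversal_set f : {set 'I_n} := [set v c (f c) | c : K].
Local Notation T f := (edges (transversal_set f)).

Lemma card_transversalI f g :
  #|transversal_set f :&: transversal_set g| = #|[set c | f c == g c]|.
Proof.
rewrite (_ : _ :&: _ = [set v c (f c) | c in [set c | f c == g c]]).
  by rewrite card_imset// => c c' /v_inj[].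
apply/setP => x; rewrite inE; apply/andP/imsetP.
  move=> [/imsetP[c _ ->] /imsetP[c' _ /v_inj[<- fg]]].
  by exists c => //; rewrite inE fg.
move=> [c]; rewrite inE => /eqP fg ->.
by split; apply/imsetP; exists c; rewrite // fg.
Qed.

(** The constraint is imposed cell by cell, so the sum factors over [K]: cells in [Y] contribute 1,
    the others [b]. *)
Lemma sum_agree g (Y : {set K}) :
  \sum_(f : {ffun K -> 'I_b}) ([forall c in Y, f c == g c]%:R : R) =
  b%:R ^+ #|K| * (b%:R^-1 : R) ^+ #|Y|.
Proof.
have b0 : (b%:R : R) != 0 by rewrite pnatr_eq0 -lt0n.
transitivity (\sum_(f : {ffun K -> 'I_b})
    \prod_c ((if c \in Y then (f c == g c)%:R else 1) : R)).
  apply: eq_bigr => f _; have [/forall_inP fg|] := boolP [forall c in Y, f c == g c].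
    by rewrite big1// => c _; case: ifP => // /fg ->.
  by case/forall_inPn=> c cY fgc; rewrite (bigD1 c)//= cY (negbTE fgc) mul0r.
rewrite -(bigA_distr_bigA (fun c j => if c \in Y then (j == g c)%:R else 1 : R)) /=.
rewrite (bigID (mem Y)) /= [X in X * _]big1 => [|c cY]; last first.
  rewrite cY (bigD1 (g c))//= eqxx big1 ?addr0// => j /negbTE ->//.
rewrite mul1r (eq_bigr (fun=> b%:R)) => [|c /negbTE ->]; last first.
  by rewrite sumr_const card_ord.
rewrite prodr_const -(cardC Y) exprD exprVn mulrAC mulfV ?mul1r ?expf_neq0//.
Qed.

Variables (p : R) (h : nat -> R) (rho : R).
Hypothesis pE : forall f, prob_absent pr (T f) = p.
Hypothesis h_ge0 : forall m, 0 <= h m.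
Hypothesis h_bound : forall f (X : {set 'I_n}), X \subset transversal_set f ->
  (prob_absent pr (edges X))^-1 <= h #|X|.
Hypothesis rho_bound :
  \sum_(Y : {set K} | (1 < #|Y|)%N) h #|Y| * b%:R^-1 ^+ #|Y| <= rho.

(** The shared edges are those inside the common vertices, so the joint probability is [p ^+ 2]
    divided by that of the shared edges, at most [p ^+ 2 * h m] for [m] common vertices, and a
    shared edge forces [m > 1]. Replacing the exact agreement set by a sum over all [Y] on which [f]
    and [g] agree only overcounts, and lets [sum_agree] evaluate the sum over [f]. *)
Lemma sum_overlap g :
  \sum_(f : {ffun K -> 'I_b}) (~~ [disjoint T f & T g])%:R * prob_absent pr (T f :|: T g)
  <= b%:R ^+ #|K| * (p ^+ 2 * rho).
Proof.
have p0 : 0 < p by rewrite -(pE g) prob_absent_gt0.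
pose A (f : {ffun K -> 'I_b}) := [set c | f c == g c].
pose S : R := \sum_(f : {ffun K -> 'I_b}) \sum_(Y : {set K} | (1 < #|Y|)%N)
    [forall c in Y, f c == g c]%:R * (p ^+ 2 * h #|Y|).
apply: (@le_trans _ _ S).
  apply: ler_sum => f _.
  have [_|] := boolP [disjoint _ & _].
    rewrite mul0r sumr_ge0// => Y _.
    by rewrite mulr_ge0 ?ler0n// mulr_ge0// sqr_ge0.
  rewrite -setI_eq0 edgesI mul1r => nd.
  have A2 : (1 < #|A f|)%N.
    rewrite ltnNge; apply: contra nd => A1; apply/eqP; apply: edges_small.
    by rewrite card_transversalI ltnS.
  rewrite (bigD1 (A f))//= (_ : [forall c in _, _]); last first.
    by apply/forall_inP => c; rewrite inE.
  rewrite mul1r prob_absentUI !pE edgesI -expr2 -[leLHS]addr0 lerD//.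
    rewrite ler_wpM2l ?sqr_ge0// -card_transversalI; apply: (h_bound (f := g)).
    exact: subsetIr.
  by rewrite sumr_ge0// => Y _; rewrite mulr_ge0 ?ler0n// mulr_ge0// sqr_ge0.
rewrite /S exchange_big /=.
under eq_bigr do rewrite -mulr_suml sum_agree.
rewrite (_ : \sum_(_ | _) _ = b%:R ^+ #|K| * (p ^+ 2 *
  \sum_(Y : {set K} | (1 < #|Y|)%N) h #|Y| * b%:R^-1 ^+ #|Y|)).
  by rewrite !ler_wpM2l ?sqr_ge0// exprn_ge0// ler0n.
by rewrite !mulr_sumr; apply: eq_bigr => Y _; ring.
Qed.

(* Greedy choice: averaging over all transversals yields one that overlaps little
   with those already chosen, so that Janson's step gains a factor 1 - p/2. *)
Lemma transversal_tail M : M%:R * (p * rho) <= 2^-1 ->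
  Ex pr (fun w => [forall f : {ffun K -> 'I_b}, ~~ absent (T f) w]%:R)
    <= (1 - p / 2) ^+ M.
Proof.
have pr01' e : 0 <= pr e <= 1 by have /andP[-> /ltW] := pr01 e.
move=> MM; suff [l sl Hl] : exists2 l : seq {ffun K -> 'I_b}, size l = M &
    Ex pr (fun w => (none_absent (fun f => T f) l w)%:R) <= (1 - p / 2) ^+ M.
  apply: le_trans Hl; apply: ler_Ex => // w.
  rewrite ler_nat; case: forallP => // nw.
  by rewrite (_ : none_absent _ _ _)//; apply/allP => f _.
have g0 : {ffun K -> 'I_b} := [ffun=> Ordinal b_gt0].
have p0 : 0 < p by rewrite -(pE g0) prob_absent_gt0.
have rho0 : 0 <= rho.
  by apply: le_trans rho_bound; rewrite sumr_ge0// => Y _;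
    rewrite mulr_ge0// exprn_ge0// invr_ge0 ler0n.
elim: M MM => [|M IH] MM.
  exists [::] => //; rewrite expr0 (eq_Ex _ (g := fun=> 1)) ?Ex_cst//.
have [|l sl Hl] := IH.
  by apply: le_trans MM; rewrite ler_wpM2r ?ler_nat// mulr_ge0// ltW.
pose S f := \sum_(g <- l | ~~ [disjoint T f & T g]) prob_absent pr (T f :|: T g).
have SE f : S f = \sum_(g <- l) (~~ [disjoint T f & T g])%:R * prob_absent pr (T f :|: T g).
  by rewrite /S big_mkcond; apply: eq_bigr => g _; case: ifP; rewrite ?mul1r ?mul0r.
have [f Sf] : exists f, S f <= p / 2.
  apply/existsP; apply: contraT; rewrite negb_exists => /forallP nS.
  have : \sum_(f : {ffun K -> 'I_b}) S f <= b%:R ^+ #|K| * (p / 2).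
    under eq_bigr do rewrite SE.
    rewrite exchange_big /=.
    apply: (@le_trans _ _ (\sum_(g <- l) b%:R ^+ #|K| * (p ^+ 2 * rho))).
      by apply: ler_sum => g _; exact: sum_overlap.
    rewrite big_const_seq count_predT sl iter_addr_0 -mulrnAr.
    rewrite ler_wpM2l ?exprn_ge0// -mulr_natl.
    rewrite (_ : _ * _ = M%:R * (p * rho) * p); last by ring.
    rewrite mulrC ler_pM2l//.
    by apply: le_trans MM; rewrite ler_wpM2r ?ler_nat// mulr_ge0// ltW.
  rewrite leNgt => /negP[].
  rewrite (_ : _ * _ = \sum_(f : {ffun K -> 'I_b}) p / 2); last first.
    by rewrite sumr_const card_ffun card_ord -[RHS]mulr_natl natrX.
  apply: ltr_sum => [|f _]; last by rewrite ltNge.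
  by apply/hasP; exists g0 => //; rewrite mem_index_enum.
exists (f :: l); first by rewrite /= sl.
apply: le_trans (janson_step pr01' _ _ _) _.
rewrite exprSr pE -/(S f).
have E0 : 0 <= Ex pr (fun w => (none_absent (fun f => T f) l w)%:R).
  by apply: Ex_ge0 => // w; rewrite ler0n.
have le1 : 1 - p + S f <= 1 - p / 2 by lra.
apply: le_trans (ler_wpM2l E0 le1) _; rewrite ler_wpM2r//.
suff : p <= 1 by lra.
rewrite -(pE f) -[leRHS](_ : \prod_(e in T f) 1 = 1); last by rewrite big1.
by apply: ler_prod => e _; have /andP[? ?] := pr01 e; lra.
Qed.

End Transversals.

(** * Sparse profiles and conic combinations *)

Lemma linear_dependence (R : fieldType) (m k : nat) (x : 'I_m -> 'I_k -> R) : (k < m)%N ->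
  exists2 g : 'I_m -> R, exists c, g c != 0 & forall i, \sum_c g c * x c i = 0.
Proof.
move=> km; pose V : 'M[R]_(m, k) := \matrix_(c, i) x c i.
have : ~~ row_free V.
  by rewrite /row_free neq_ltn (leq_ltn_trans (rank_leq_col V) km).
rewrite -kermx_eq0 => /matrix0Pn[r [c rc]].
exists (kermx V r); first by exists c.
move=> i; have /rowP/(_ i) : row r (kermx V) *m V = 0.
  by apply/sub_kermxP; exact: row_sub.
rewrite !mxE => E; rewrite -[RHS]E; apply: eq_bigr => c' _.
by rewrite !mxE.
Qed.

(** While there are more than [k] vectors, a linear dependence [g] exists, and its sign can be
    chosen so that the entries of [g] have a nonnegative sum. Subtracting the largest multiple of
    [g] that keeps all coefficients nonnegative kills one vector and does not increase the total
    weight. The surviving vectors are original ones, so any property [Q] is inherited. *)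
Lemma conic_caratheodory (R : realFieldType) (k m : nat) (Q : ('I_k -> R) -> Prop)
    (x : 'I_m -> 'I_k -> R) (b : 'I_m -> R) :
  (forall c, Q (x c)) -> (forall c, 0 <= b c) ->
  exists m' (x' : 'I_m' -> 'I_k -> R) (b' : 'I_m' -> R),
    [/\ (m' <= k)%N, forall c, Q (x' c), forall c, 0 <= b' c,
        forall i, \sum_c b' c * x' c i = \sum_c b c * x c i &
        \sum_c b' c <= \sum_c b c].
Proof.
elim: m x b => [|m IH] x b Qx b0.
  by exists 0%N, x, b; split.
have [mk|km] := leqP m.+1 k; first by exists m.+1, x, b; split.
have [g [c0 gc0] gx] : exists2 g : 'I_m.+1 -> R,
    exists c, 0 < g c & 0 <= \sum_c g c /\ forall i, \sum_c g c * x c i = 0.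
  have [g [c gc] gx] := linear_dependence x km.
  wlog g0 : g gc gx / 0 <= \sum_c g c.
    move=> W; have [|/ltW g0] := leP 0 (\sum_c g c); first exact: W.
    apply: (W (fun c => - g c)); rewrite ?oppr_eq0 ?sumrN ?oppr_ge0// => i.
    by rewrite (eq_bigr (fun c => - (g c * x c i))) ?sumrN ?gx ?oppr0// => c' _; rewrite mulNr.
  exists g => //; apply/existsP; apply: contraT; rewrite negb_exists => /forallP gle.
  have gle' c' : true -> 0 <= - g c' by move=> _; rewrite oppr_ge0 leNgt gle.
  have : \sum_c' - g c' = 0.
    by apply/eqP; rewrite eq_le sumr_ge0// andbT sumrN oppr_le0.
  move/psumr_eq0P => /(_ gle')/(_ c isT)/eqP; rewrite oppr_eq0.
  by rewrite (negbTE gc).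
have [c cg cmin] : exists2 c, 0 < g c & forall c', 0 < g c' -> b c / g c <= b c' / g c'.
  case: (@Order.TotalTheory.arg_minP _ R _ c0 (fun c => 0 < g c) (fun c => b c / g c) gc0).
  by move=> c cg cmin; exists c.
case: gx => g0 gx; pose s := b c / g c.
have s0 : 0 <= s by rewrite divr_ge0// ltW.
pose b1 c' := b c' - s * g c'.
have b1c : b1 c = 0 by rewrite /b1 /s divfK ?subrr// gt_eqF.
have b10 c' : 0 <= b1 c'.
  rewrite subr_ge0; have [gc'|gc'] := ltP 0 (g c').
    by rewrite -ler_pdivlMr// cmin.
  by apply: le_trans (b0 c'); rewrite mulr_ge0_le0.
have split_c (F : 'I_m.+1 -> R) : \sum_c' b1 c' * F c' = \sum_c' b1 (lift c c') * F (lift c c').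
  by rewrite (bigD1_ord c)//= b1c mul0r add0r.
have [m' [x' [b' [m'k Qx' b'0 E S]]]] :=
  IH (fun c' => x (lift c c')) (fun c' => b1 (lift c c'))
  (fun c' => Qx _) (fun c' => b10 _).
exists m', x', b'; split => //.
  move=> i; rewrite E -(split_c (fun c' => x c' i)) /b1.
  under eq_bigr do rewrite mulrBl -mulrA.
  by rewrite sumrB -mulr_sumr gx mulr0 subr0.
apply: le_trans S _; have := split_c (fun=> 1).
under eq_bigr do rewrite mulr1; under [in RHS]eq_bigr do rewrite mulr1.
by move=> <-; rewrite /b1 sumrB -mulr_sumr gerBl mulr_ge0.
Qed.

Section Sparse.
Variables (R : realFieldType) (k : nat) (a : 'I_k -> 'I_k -> R).
Hypothesis a_ge0 : forall i j, 0 <= a i j.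
Implicit Types (x y : 'I_k -> R) (c s : R).

Definition quad x (J : {set 'I_k}) : R := \sum_(i in J) \sum_(j in J) a i j * x i * x j.
Definition sparse c x := forall J : {set 'I_k}, quad x J <= c * \sum_(i in J) x i.

(* Round y to a random face of the box: keep each coordinate i, at its full value
   x i, with probability y i / x i.  This preserves the linear term and can only
   increase the quadratic one. *)
Lemma sparse_box c x y : sparse c x -> (forall i, 0 <= y i <= x i) ->
  quad y setT <= c * \sum_i y i.
Proof.
move=> sx yx; pose p i := y i / x i.
have p01 i : 0 <= p i <= 1.
  have /andP[y0 le_yx] := yx i; have x0 := le_trans y0 le_yx.
  rewrite /p divr_ge0//=; have [->|xi0] := eqVneq (x i) 0; first by rewrite invr0 mulr0.
  by rewrite ler_pdivrMr ?mul1r// lt_def xi0.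
have px i : p i * x i = y i.
  have /andP[y0 le_yx] := yx i.
  rewrite /p; have [xi0|xi0] := eqVneq (x i) 0; last by rewrite divfK.
  by rewrite xi0 mulr0; apply/eqP; rewrite eq_le y0 -xi0 le_yx.
(* The random face [J w] consists of the coordinates that are off, so that [Ex_absent_cst] gives its
   law; hence the complementary probability. *)
pose pr i := 1 - p i.
have pr01 i : 0 <= pr i <= 1 by have /andP[? ?] := p01 i; rewrite /pr; lra.
pose J (w : {ffun 'I_k -> bool}) := [set i | ~~ w i].
have inJ (w : {ffun 'I_k -> bool}) i : ((i \in J w)%:R : R) = (absent [set i] w)%:R.
  rewrite inE; congr (nat_of_bool _)%:R; apply/idP/forall_inP => [wi e|].
    by rewrite inE => /eqP ->.
  by apply; rewrite inE.
have inJ2 (w : {ffun 'I_k -> bool}) i j :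
    ((i \in J w)%:R * (j \in J w)%:R : R) = (absent [set i; j] w)%:R.
  rewrite !inE -natrM mulnb; congr (nat_of_bool _)%:R; apply/andP/forall_inP.
    by move=> [wi wj] e; rewrite !inE => /orP[]/eqP ->.
  by move=> H; split; apply: H; rewrite !inE eqxx ?orbT.
have Ex1 i : Ex pr (fun w => (i \in J w)%:R) = p i.
  by rewrite (eq_Ex _ (fun w => inJ w i)) Ex_absent_cst /prob_absent big_set1 /pr; ring.
(* Equality holds off the diagonal by independence; on the diagonal the right side is [p i], at
   least [p i * p i]. Only the diagonal terms of [quad] grow. *)
have Ex2 i j : p i * p j <= Ex pr (fun w => (i \in J w)%:R * (j \in J w)%:R).
  rewrite (eq_Ex _ (fun w => inJ2 w i j)) Ex_absent_cst /prob_absent /pr.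
  have /andP[i0 i1] := p01 i; have [<-|ij] := eqVneq i j.
    by rewrite setUid big_set1 opprB addrC subrK ler_piMr.
  by rewrite big_setU1 ?inE//= big_set1; lra.
have ExZ (cc : R) f : Ex pr (fun w => cc * f w) = cc * Ex pr f.
  by rewrite /Ex mulr_sumr; apply: eq_bigr => w _; ring.
have <- : Ex pr (fun w => c * \sum_(i in J w) x i) = c * \sum_i y i.
  rewrite ExZ; congr (_ * _).
  rewrite (eq_Ex _ (g := fun w => \sum_i x i * (i \in J w)%:R)) => [|w].
    by rewrite Ex_sum; apply: eq_bigr => i _; rewrite ExZ Ex1 mulrC px.
  by rewrite big_mkcond; apply: eq_bigr => i _; case: ifP; rewrite ?mulr1 ?mulr0.
apply: (@le_trans _ _ (Ex pr (fun w => quad x (J w)))); last exact: ler_Ex.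
rewrite (eq_Ex _ (g := fun w => \sum_i \sum_j a i j * x i * x j *
    ((i \in J w)%:R * (j \in J w)%:R))) => [|w].
  rewrite Ex_sum /quad; under eq_bigl do rewrite inE.
  apply: ler_sum => i _; rewrite Ex_sum; under eq_bigl do rewrite inE.
  apply: ler_sum => j _; rewrite ExZ -!px.
  have /andP[yi _] := yx i; have /andP[yj _] := yx j.
  have xi : 0 <= x i by have /andP[] := yx i; exact: le_trans.
  have xj : 0 <= x j by have /andP[] := yx j; exact: le_trans.
  rewrite (_ : _ * _ = a i j * x i * x j * (p i * p j)); last by ring.
  by rewrite ler_wpM2l// !mulr_ge0.
rewrite /quad big_mkcond; apply: eq_bigr => i _.
case: ifP => _; last by rewrite big1// => j _; rewrite mul0r mulr0.
rewrite big_mkcond; apply: eq_bigr => j _.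
by case: ifP; rewrite mul1r ?mulr1 ?mulr0.
Qed.

(** The condition at [J] is [sparse_box] for [y] set to zero off [J]. Coordinates may therefore be
    shrunk by different factors without losing sparsity. *)
Lemma sparse_le c x y : sparse c x -> (forall i, 0 <= y i <= x i) -> sparse c y.
Proof.
move=> sx yx J; pose z i := if i \in J then y i else 0.
have := @sparse_box c x z sx; rewrite /quad /z.
have -> : \sum_i (if i \in J then y i else 0) = \sum_(i in J) y i by rewrite -big_mkcond.
move=> H; apply: le_trans (H _); last first.
  by move=> i; case: ifP => // _; rewrite lexx; have /andP[] := yx i; exact: le_trans.
rewrite le_eqVlt; apply/orP; left; apply/eqP.
under [RHS]eq_bigl do rewrite inE.
rewrite big_mkcond; apply: eq_bigr => i _; case: ifP => iJ; last first.
  by rewrite big1// => j _; rewrite mulr0 mul0r.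
under [RHS]eq_bigl do rewrite inE.
by rewrite big_mkcond; apply: eq_bigr => j _; case: ifP => //; rewrite mulr0.
Qed.

Lemma sparseZ s c x : 0 <= s -> sparse c x -> sparse (s * c) (fun i => s * x i).
Proof.
move=> s0 sx J; rewrite -mulr_sumr (_ : quad _ J = s * (s * quad x J)).
  by rewrite -mulrA ler_wpM2l// mulrCA ler_wpM2l.
rewrite /quad !mulr_sumr; apply: eq_bigr => i _; rewrite !mulr_sumr.
by apply: eq_bigr => j _; ring.
Qed.

End Sparse.

(** * Types of the vertices *)

Section TypeDistribution.
Variables (R : realFieldType) (k n : nat) (s : 'I_k -> R).
Hypothesis s_ge0 : forall i, 0 <= s i.
Hypothesis s_sum : \sum_i s i = 1.
Implicit Types (t : {ffun 'I_n -> 'I_k}).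

Definition type_prob t : R := \prod_j s (t j).

Lemma type_prob_ge0 t : 0 <= type_prob t.
Proof. exact: prodr_ge0. Qed.

Lemma sum_type_probM (G : 'I_n -> 'I_k -> R) :
  \sum_t type_prob t * \prod_j G j (t j) = \prod_j \sum_i s i * G j i.
Proof.
rewrite bigA_distr_bigA /=; apply: eq_bigr => t _.
by rewrite /type_prob -big_split.
Qed.

Lemma sum_type_prob : \sum_t type_prob t = 1.
Proof.
have := sum_type_probM (fun _ _ => 1).
rewrite (eq_bigr type_prob) => [->|t _]; last by rewrite big1 ?mulr1.
by apply: big1 => j _; rewrite -[RHS]s_sum; apply: eq_bigr => i _; rewrite mulr1.
Qed.

Let Y (i x : 'I_k) : R := (x == i)%:R - s i.

Lemma sum_Y i : \sum_x s x * Y i x = 0.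
Proof.
rewrite /Y; under eq_bigr do rewrite mulrBr.
rewrite sumrB -mulr_suml s_sum mul1r (bigD1 i)//= eqxx mulr1 big1 ?addr0 ?subrr//.
by move=> j /negbTE ->; rewrite mulr0.
Qed.

Lemma sum_Y2 i : \sum_x s x * Y i x ^+ 2 <= s i.
Proof.
have -> : \sum_x s x * Y i x ^+ 2 =
    \sum_x (1 - s i) * (s x * Y i x) + \sum_x s i * (s x * (x != i)%:R).
  rewrite -big_split; apply: eq_bigr => x _ /=; rewrite /Y.
  by case: eqP => [->|_] /=; ring.
rewrite -mulr_sumr sum_Y mulr0 add0r -mulr_sumr ler_piMr// -[leRHS]s_sum ler_sum// => x _.
by apply: ler_piMr; rewrite ?lern1 ?leq_b1.
Qed.

(** [G] spreads the two centred indicators over a product indexed by all vertices, so that the sum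
    factors; for distinct [j] and [l] one factor is the mean [sum_Y], which vanishes. *)
Lemma sum_type_probYY i j l : \sum_t type_prob t * (Y i (t j) * Y i (t l)) <=
  (if j == l then s i else 0).
Proof.
pose G j' x := if j' == j then (if j' == l then Y i x ^+ 2 else Y i x)
  else if j' == l then Y i x else 1.
have -> : \sum_t type_prob t * (Y i (t j) * Y i (t l)) = \prod_j' \sum_x s x * G j' x.
  rewrite -sum_type_probM; apply: eq_bigr => t _; congr (_ * _).
  rewrite /G (bigD1 j)//= eqxx; have [<-|jl] := eqVneq j l.
    by rewrite big1 ?mulr1 ?expr2// => j' /negbTE ->.
  congr (_ * _); rewrite (bigD1 l) 1?eq_sym//= eqxx (negbTE jl) big1 ?mulr1//.
  by move=> j' /andP[/negbTE -> /negbTE ->].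
have sG1 j' : j' != j -> j' != l -> \sum_x s x * G j' x = 1.
  move=> /negbTE j'j /negbTE j'l; rewrite -[RHS]s_sum; apply: eq_bigr => x _.
  by rewrite /G j'j j'l mulr1.
rewrite (bigD1 j)//=; have [jl|jl] := eqVneq j l.
  rewrite [X in _ * X]big1 ?mulr1 => [|j' j'j]; last by rewrite sG1// -jl.
  by rewrite /G eqxx jl eqxx sum_Y2.
by rewrite {1}/G eqxx (negbTE jl) sum_Y mul0r.
Qed.

Definition occupancy t i : R := \sum_j (t j == i)%:R.

Lemma occupancy_variance i :
  \sum_t type_prob t * (occupancy t i - n%:R * s i) ^+ 2 <= n%:R * s i.
Proof.
have E t : (occupancy t i - n%:R * s i) ^+ 2 = \sum_j \sum_l Y i (t j) * Y i (t l).
  have -> : occupancy t i - n%:R * s i = \sum_j Y i (t j).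
    by rewrite /Y sumrB sumr_const card_ord mulr_natl.
  by rewrite expr2 big_distrlr.
under eq_bigr do rewrite E mulr_sumr.
rewrite exchange_big /=.
apply: (@le_trans _ _ (\sum_(j < n) s i)); last by rewrite sumr_const card_ord mulr_natl.
apply: ler_sum => j _; under eq_bigr do rewrite mulr_sumr.
rewrite exchange_big /=.
apply: (@le_trans _ _ (\sum_(l < n) (if j == l then s i else 0))).
  by apply: ler_sum => l _; exact: sum_type_probYY.
by rewrite -big_mkcond /= (bigD1 j)//= big1 ?addr0// => l /andP[/eqP ->]; rewrite eqxx.
Qed.

(* For s i = 0 the bound reads 0 <= 0: almost surely no vertex has type i. *)
Lemma occupancy_tail i (h : R) : 0 < h ->
  \sum_(t | h * (n%:R * s i) < `|occupancy t i - n%:R * s i|) type_prob t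
    <= (h ^+ 2 * n%:R * s i)^-1.
Proof.
move=> h0; set Z := fun t => occupancy t i - n%:R * s i; set m := n%:R * s i.
have m0 : 0 <= m by rewrite mulr_ge0.
have var : \sum_t type_prob t * Z t ^+ 2 <= m by exact: occupancy_variance.
have [mE|mN] := eqVneq m 0.
  rewrite (_ : _ * n%:R * s i = 0) ?invr0; last by rewrite -mulrA -/m mE mulr0.
  rewrite big1// => t; rewrite -/(Z t) mE mulr0 normr_gt0 => Zt.
  have F0 t' : true -> 0 <= type_prob t' * Z t' ^+ 2.
    by move=> _; rewrite mulr_ge0 ?sqr_ge0 ?type_prob_ge0.
  have S0 : \sum_t type_prob t * Z t ^+ 2 = 0.
    by apply/le_anti/andP; split; [rewrite -[leRHS]mE|exact: sumr_ge0].
  have /eqP : type_prob t * Z t ^+ 2 = 0 by apply: (psumr_eq0P F0 S0).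
  by rewrite mulf_eq0 expf_eq0 (negbTE Zt) andbF orbF => /eqP.
have mp : 0 < m by rewrite lt_def mN.
have hm : 0 < (h * m) ^+ 2 by rewrite exprn_gt0// mulr_gt0.
have -> : (h ^+ 2 * n%:R * s i)^-1 = m / (h * m) ^+ 2.
  by rewrite -mulrA -/m; field; rewrite !gt_eqF.
rewrite ler_pdivlMr//; apply: le_trans var.
rewrite mulr_suml [leRHS](bigID (fun t => h * m < `|Z t|))/= -[leLHS]addr0 lerD//.
  apply: ler_sum => t ht; rewrite ler_wpM2l ?type_prob_ge0//.
  rewrite -[Z t ^+ 2]real_normK ?num_real// lerXn2r ?nnegrE ?(ltW ht)//.
  by rewrite mulr_ge0// ltW.
by apply: sumr_ge0 => t _; rewrite mulr_ge0 ?sqr_ge0 ?type_prob_ge0.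
Qed.

End TypeDistribution.

From mathcomp Require Import all_classical all_reals all_analysis.
From mathcomp Require Import measurable_realfun finmap.

Import numFieldNormedType.Exports.

(** * Independent sets in the block model *)

Lemma sum_exp_card (R : realType) (K : finType) (r : R) :
  \sum_(Y : {set K}) r ^+ #|Y| = (1 + r) ^+ #|K|.
Proof.
rewrite addrC -prodr_const bigA_distr.
by apply: eq_bigr => Y _; rewrite -big_mkcond/= prodr_const.
Qed.

Section BlockModel.
Variables (R : realType) (k n : nat) (a : 'I_k -> 'I_k -> R) (t : 'I_n -> 'I_k).
Implicit Types S : {set 'I_n}.
Hypothesis a_ge0 : forall i j, 0 <= a i j.
Hypothesis a_sym : forall i j, a i j = a j i.

(* Only the coordinates (i, j) with i < j carry an edge; the others are almost
   surely off. *)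
Definition edge_prob (e : 'I_n * 'I_n) : R :=
  if (e.1 < e.2)%N then 1 - expR (- a (t e.1) (t e.2)) else 0.

Lemma edge_prob01 e : 0 <= edge_prob e < 1.
Proof.
rewrite /edge_prob; case: ifP => _; last by rewrite lexx ltr01.
by rewrite subr_ge0 ltrBlDr ltrDl expR_gt0 andbT -expR0 ler_expR oppr_le0.
Qed.

Definition type_count (S : {set 'I_n}) (i : 'I_k) : nat :=
  #|[set x in S | t x == i]|.

(** Minus the logarithm of the probability that [S] is independent. *)
Definition energy (S : {set 'I_n}) : R := \sum_(e in edges S) a (t e.1) (t e.2).

Lemma prob_absent_edges S : prob_absent edge_prob (edges S) = expR (- energy S).
Proof.
rewrite /energy -sumrN expR_sum; apply: eq_bigr => e.
by rewrite inE => /and3P[_ _ lt_e]; rewrite /edge_prob lt_e subKr.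
Qed.

Lemma sum_type_count S (F : 'I_k -> R) :
  \sum_(x in S) F (t x) = \sum_i (type_count S i)%:R * F i.
Proof.
rewrite (partition_big t predT)//=; apply: eq_bigr => i _.
rewrite (eq_bigr (fun=> F i)) => [|x /andP[_ /eqP->]//].
by rewrite sumr_const mulr_natl; congr (_ *+ _); apply: eq_card => x; rewrite !inE.
Qed.

Lemma card_type_count S : #|S|%:R = \sum_i (type_count S i)%:R :> R.
Proof.
rewrite -sumr_const (sum_type_count _ (fun=> 1)).
by apply: eq_bigr => i _; rewrite mulr1.
Qed.

(** The double sum runs over ordered pairs of vertices and includes the pairs [(x, x)], which carry
    no edge. This diagonal is the source of the extra [L] in [sparse_independent]. *)
Lemma energyE S : 2 * energy S =
  \sum_i \sum_j a i j * (type_count S i)%:R * (type_count S j)%:R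
  - \sum_i a i i * (type_count S i)%:R.
Proof.
have -> : \sum_i \sum_j a i j * (type_count S i)%:R * (type_count S j)%:R
    = \sum_(x in S) \sum_(y in S) a (t x) (t y).
  rewrite (sum_type_count S (fun i => \sum_(y in S) a i (t y))).
  apply: eq_bigr => i _; rewrite (sum_type_count S (a i)) mulr_sumr.
  by apply: eq_bigr => j _; ring.
have -> : \sum_i a i i * (type_count S i)%:R = \sum_(x in S) a (t x) (t x).
  by rewrite (sum_type_count S (fun i => a i i)); apply: eq_bigr => i _; ring.
have En : energy S = \sum_(x in S) \sum_(y in S | (x < y)%N) a (t x) (t y).
  rewrite /energy pair_big_dep /=; apply: eq_bigl => e.
  by rewrite inE.
have En' : energy S = \sum_(x in S) \sum_(y in S | (y < x)%N) a (t x) (t y).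
  rewrite En (exchange_big_dep (mem S)) /= => [|x y _ /andP[]//].
  apply: eq_bigr => x xS; apply: eq_big => [y|y _]; last exact: a_sym.
  by rewrite xS /= andbC; case: (y \in S).
rewrite mulr2n mulrDl !mul1r {1}En En' -big_split /= -sumrB; apply: eq_bigr => x xS.
rewrite [in RHS](bigD1 x)//= [in RHS]addrAC subrr add0r.
rewrite [in RHS](bigID (fun y : 'I_n => (x < y)%N)) /=.
congr (_ + _); apply: eq_bigl => y; case: (y \in S) => //=.
  by rewrite -val_eqE /=; case: ltngtP.
by rewrite -val_eqE /=; case: ltngtP.
Qed.

Lemma le_energy S : energy S <=
  2^-1 * \sum_i \sum_j a i j * (type_count S i)%:R * (type_count S j)%:R.
Proof.
have := energyE S; have : 0 <= \sum_i a i i * (type_count S i)%:R.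
  by apply: sumr_ge0 => i _; rewrite mulr_ge0 ?ler0n.
lra.
Qed.

Lemma energy_card S (L : R) : (forall i j, a i j <= L) -> energy S <= L * #|S|%:R ^+ 2.
Proof.
move=> aL; apply: (@le_trans _ _ (\sum_(x in S) \sum_(y in S) L)).
  rewrite /energy pair_big_dep /= big_mkcond [leRHS]big_mkcond /=.
  apply: ler_sum => e _; rewrite inE.
  have L0 : 0 <= L by apply: le_trans (aL (t e.1) (t e.2)).
  case: (e.1 \in S) => //=; case: (e.2 \in S) => //=.
  by case: ifP.
by rewrite !sumr_const -mulrnA -[leLHS]mulr_natr natrM expr2.
Qed.

(** A union bound in which each nonempty [U] counted is independent with probability at most
    [r ^+ #|U|]; the binomial theorem sums these bounds. *)
Lemma first_moment (r : R) : 0 <= r ->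
  Ex edge_prob (fun w => [exists U : {set 'I_n}, [&& U != finset.set0,
     expR (- energy U) <= r ^+ #|U| & absent (edges U) w]]%:R) <= (1 + r) ^+ n - 1.
Proof.
move=> r0.
have pr01 e : 0 <= edge_prob e <= 1 by have /andP[-> /ltW] := edge_prob01 e.
have -> : (1 + r) ^+ n - 1 = \sum_(U : {set 'I_n} | U != finset.set0) r ^+ #|U|.
  rewrite -[n in LHS]card_ord -sum_exp_card.
  by rewrite (bigD1 finset.set0)//= cards0 expr0 addrC addrK.
pose F (U : {set 'I_n}) w : R :=
  (expR (- energy U) <= r ^+ #|U|)%R%:R * (absent (edges U) w)%:R.
apply: (@le_trans _ _ (Ex edge_prob (fun w =>
    \sum_(U : {set 'I_n} | U != finset.set0) F U w))).
  apply: ler_Ex => // w; case: existsP => [[U /and3P[U0 EU aU]]|_]; last first.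
    by rewrite sumr_ge0// => U _; rewrite mulr_ge0 ?ler0n.
  have F0 U' : 0 <= F U' w by rewrite /F mulr_ge0 ?ler0n.
  by rewrite (bigD1 U)//= {1}/F EU aU mulr1 lerDl sumr_ge0.
rewrite [leLHS](_ : _ = \sum_(U : {set 'I_n} | U != finset.set0) Ex edge_prob (F U));
  last exact: Ex_sum.
apply: ler_sum => U _; rewrite /F.
have [EU|_] := boolP (expR (- energy U) <= r ^+ #|U|); last first.
  by rewrite (eq_Ex _ (g := fun=> 0)) ?Ex_cst ?exprn_ge0// => w; rewrite mul0r.
rewrite (eq_Ex _ (g := fun w => (absent (edges U) w)%:R)) => [|w]; last by rewrite mul1r.
by rewrite Ex_absent_cst prob_absent_edges.
Qed.

End BlockModel.

(** * Finding an independent set with a prescribed sparse profile *)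

Section ProfileTail.
Variables (R : realType) (k n : nat) (a : 'I_k -> 'I_k -> R) (t : 'I_n -> 'I_k).
Hypothesis n_gt0 : (0 < n)%N.
Hypothesis a_ge0 : forall i j, 0 <= a i j.
Hypothesis a_sym : forall i j, a i j = a j i.
Variables (L : R) (aL : forall i j, a i j <= L).
Variables (l d : R) (b c : nat) (q : 'I_k -> nat) (U : {set 'I_n}).
Hypothesis b_gt0 : (0 < b)%N.
Hypothesis c_gt0 : (0 < c)%N.
Hypothesis qc : (\sum_i q i <= c)%N.
Hypothesis Uq : forall i, (q i * b <= type_count t U i)%N.
Hypothesis q_sparse : forall y : 'I_k -> nat, (forall i, (y i <= q i)%N) ->
  \sum_i \sum_j a i j * (y i)%:R * (y j)%:R <= 2 * ((1 - d) * l) * \sum_i (y i)%:R.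
(* The two terms of the minimum bound the energy of an m-subset of a set with
   profile q: by sparsity for large m, by the number of pairs for small m. *)
Hypothesis numeric : forall m, (1 < m)%N ->
  Num.min ((1 - d) * l * m%:R) (L * m%:R ^+ 2) + m%:R * (ln c%:R - ln b%:R)
  <= - (3 / 2 * l).

Let x0 : 'I_n := Ordinal n_gt0.
Let qc1 i : (q i <= c)%N.
Proof. by apply: leq_trans qc; rewrite (bigD1 i)//= leq_addr. Qed.

Local Notation cell := {x : 'I_k * 'I_c | (x.2 < q x.1)%N}.
Definition typed (i : 'I_k) : {set 'I_n} := [set x in U | t x == i].
(** The cell [(i, r)] is the [r]-th run of [b] consecutive vertices in the enumeration of the type
    [i] part of [U]. By [Uq] there is room for [q i] such runs, so the default [x0] is never
    returned. *)
Definition place (x : cell) (j : 'I_b) : 'I_n :=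
  nth x0 (enum (typed (val x).1)) ((val x).2 * b + j).

Lemma place_bound (x : cell) (j : 'I_b) :
  ((val x).2 * b + j < size (enum (typed (val x).1)))%N.
Proof.
rewrite -cardE; apply: leq_trans (Uq (val x).1).
apply: (@leq_trans ((val x).2.+1 * b)); last by rewrite leq_mul2r (valP x) orbT.
by rewrite mulSn addnC ltn_add2r.
Qed.

Lemma place_typed x j : place x j \in typed (val x).1.
Proof. by rewrite -mem_enum mem_nth// place_bound. Qed.

Lemma place_type x j : t (place x j) = (val x).1.
Proof. by have := place_typed x j; rewrite inE => /andP[_ /eqP]. Qed.

Lemma place_inj x j x' j' : place x j = place x' j' -> x = x' /\ j = j'.
Proof.
move=> E; have E1 : (val x).1 = (val x').1 by rewrite -(place_type x j) -(place_type x' j') E.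
move: E; rewrite /place => /eqP; rewrite -E1 nth_uniq ?enum_uniq//; last 2 first.
- exact: place_bound.
- by rewrite E1 place_bound.
move=> /eqP E.
have E2 : (((val x).2 * b + j) %/ b = ((val x').2 * b + j') %/ b)%N by rewrite E.
have E3 : (((val x).2 * b + j) %% b = ((val x').2 * b + j') %% b)%N by rewrite E.
move: E2 E3; rewrite !divnMDl// !divn_small// !addn0 !modnMDl !modn_small// => E2 E3.
split; last exact: val_inj.
apply: val_inj; move: (val x) (val x') E1 E2 => [x1 x2] [y1 y2] /= ->.
by move=> /val_inj ->.
Qed.

Lemma type_count_transversal (f : {ffun cell -> 'I_b}) i :
  type_count t (transversal_set place f) i = q i.
Proof.
pose mk (j : 'I_(q i)) : cell :=
  @exist ('I_k * 'I_c) (fun x => (x.2 < q x.1)%N) (i, widen_ord (qc1 i) j) (ltn_ord j).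
rewrite /type_count (_ : [set x in _ | _] = [set place (mk j) (f (mk j)) | j : 'I_(q i)]%SET).
  rewrite card_imset ?card_ord// => j j' /place_inj[/(congr1 val) /= [E] _].
  exact: val_inj.
apply/setP => x; rewrite !inE; apply/andP/imsetP.
  move=> [/imsetP[y _ ->]]; rewrite place_type => /eqP E.
  have yq : ((val y).2 < q i)%N by rewrite -E; exact: (valP y).
  exists (Ordinal yq) => //.
  suff <- : y = mk (Ordinal yq) by [].
  by apply: val_inj; case: (val y) E yq => y1 y2 /= -> yq; congr (_, _); exact: val_inj.
move=> [j _ ->]; split; last by rewrite place_type.
by apply/imsetP; exists (mk j).
Qed.

Lemma card_cell : (#|{: cell}| <= c)%N.
Proof.
apply: leq_trans qc; pose f : {ffun cell -> 'I_b} := [ffun=> Ordinal b_gt0].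
have <- : #|transversal_set place f| = #|{: cell}|.
  by rewrite card_imset// => x y /place_inj[].
rewrite -(@ler_nat R) (card_type_count _ t) natr_sum.
by rewrite ler_sum// => i _; rewrite type_count_transversal.
Qed.

Let h (m : nat) : R := expR (Num.min ((1 - d) * l * m%:R) (L * m%:R ^+ 2)).

Let h_ge0 m : 0 <= h m.
Proof. exact: expR_ge0. Qed.

(** By [numeric], a term with [m] shared cells is at most [expR (- (3 / 2 * l)) / c ^ m]. There are
    at most [c] cells, so the sum of the [c ^- #|Y|] is at most [(1 + 1 / c) ^ c <= e]: this is the
    1 in the exponent. *)
Lemma overlap_sum :
  \sum_(Y : {set cell} | (1 < #|Y|)%N) h #|Y| * b%:R^-1 ^+ #|Y| <= expR (1 - 3 / 2 * l).
Proof.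
have b0 : (0 : R) < b%:R by rewrite ltr0n.
have c0 : (0 : R) < c%:R by rewrite ltr0n.
apply: (@le_trans _ _ (\sum_(Y : {set cell}) expR (- (3 / 2 * l)) * c%:R^-1 ^+ #|Y|)).
  rewrite [leRHS](bigID (fun Y : {set cell} => (1 < #|Y|)%N)) /= -[leLHS]addr0 lerD//.
    apply: ler_sum => Y Y1; rewrite /h.
    have bE : b%:R^-1 = expR (- ln b%:R) :> R by rewrite expRN lnK ?posrE.
    have cE : c%:R^-1 = expR (- ln c%:R) :> R by rewrite expRN lnK ?posrE.
    rewrite bE cE -!expRM_natl -!expRD ler_expR.
    have := numeric Y1; lra.
  by apply: sumr_ge0 => Y _; rewrite mulr_ge0 ?expR_ge0 ?exprn_ge0 ?invr_ge0 ?ler0n.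
rewrite -mulr_sumr sum_exp_card addrC expRD mulrC ler_wpM2r ?expR_ge0//.
apply: (@le_trans _ _ (expR (c%:R^-1) ^+ #|{: cell}|)).
  by rewrite lerXn2r ?nnegrE ?expR_ge0 ?addr_ge0 ?invr_ge0 ?ler0n// addrC expR_ge1Dx.
by rewrite -expRM_natl ler_expR ler_pdivrMr// mul1r ler_nat; exact: card_cell.
Qed.

Definition has_profile (w : {ffun 'I_n * 'I_n -> bool}) :=
  [exists S : {set 'I_n}, [&& S \subset U, [forall i, type_count t S i == q i] &
     absent (edges S) w]].

Lemma profile_tail :
  Ex (edge_prob a t) (fun w => (~~ has_profile w)%:R)
    <= expR (2^-1 - expR (3 / 2 * l - 1) / 4).
Proof.
have f0 : {ffun cell -> 'I_b} := [ffun=> Ordinal b_gt0].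
pose p := expR (- energy a t (transversal_set place f0)).
have pE f : prob_absent (edge_prob a t) (edges (transversal_set place f)) = p.
  rewrite prob_absent_edges /p; congr (expR (- _)).
  have := energyE t a_sym (transversal_set place f).
  have := energyE t a_sym (transversal_set place f0).
  under eq_bigr do under eq_bigr do rewrite !type_count_transversal.
  under [X in _ - X]eq_bigr do rewrite !type_count_transversal.
  move=> E1; under eq_bigr do under eq_bigr do rewrite !type_count_transversal.
  under [X in _ - X]eq_bigr do rewrite !type_count_transversal.
  by rewrite -E1; lra.
have h_bound f (X : {set 'I_n}) : X \subset transversal_set place f ->
    (prob_absent (edge_prob a t) (edges X))^-1 <= h #|X|.
  move=> Xf; rewrite prob_absent_edges expRN invrK /h ler_expR le_min.
  rewrite energy_card// andbT.
  have /q_sparse : forall i, (type_count t X i <= q i)%N.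
    move=> i; rewrite -(type_count_transversal f i); apply: subset_leq_card.
    by apply/fintype.subsetP => x; rewrite !inE => /andP[/(fintype.subsetP Xf) -> ->].
  rewrite -card_type_count => qX; apply: le_trans (le_energy t a_ge0 a_sym X) _.
  lra.
have p0 : 0 < p by apply: expR_gt0.
have p1 : p <= 1.
  rewrite -expR0 ler_expR oppr_le0 sumr_ge0//.
pose rho := expR (1 - 3 / 2 * l).
have rho0 : 0 < rho by apply: expR_gt0.
(* The largest [M] allowed by [transversal_tail]. Since [M + 1] exceeds [1 / (2 p rho)], the
   exponent [- p M / 2] is at most [p / 2 - 1 / (4 rho)], and [p <= 1]. *)
pose M := Num.truncn ((2 * (p * rho))^-1).
have pr0 : 0 < 2 * (p * rho) by rewrite !mulr_gt0.
have M1 : M%:R <= (2 * (p * rho))^-1 by rewrite truncn_le invr_ge0 ltW.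
have M2 : (2 * (p * rho))^-1 < M%:R + 1 by rewrite natr1 truncnS_gt.
have MM : M%:R * (p * rho) <= 2^-1.
  by rewrite -ler_pdivlMr ?mulr_gt0// -invfM.
have p2 : 0 <= 1 - p / 2 by move: p1 {M1 M2 MM pr0}; lra.
have T := transversal_tail (edge_prob01 t a_ge0) b_gt0 place_inj pE
  h_ge0 h_bound overlap_sum MM.
apply: (@le_trans _ _ ((1 - p / 2) ^+ M)).
  apply: le_trans T; apply: ler_Ex => [e|w].
    by have /andP[-> /ltW] := edge_prob01 t a_ge0 e.
  have [hw|nhw] := boolP (has_profile w); first by rewrite ler0n.
  rewrite ler_nat (_ : [forall f, _])//; apply/forallP => f; apply: contra nhw => aw.
  apply/existsP; exists (transversal_set place f); rewrite aw andbT.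
  apply/andP; split; last by apply/forallP => i; rewrite type_count_transversal.
  apply/fintype.subsetP => x /imsetP[y _ ->]; have := place_typed y (f y).
  by rewrite inE => /andP[].
apply: (@le_trans _ _ (expR (- (p / 2)) ^+ M)).
  rewrite lerXn2r ?nnegrE ?expR_ge0//.
  by rewrite expR_ge1Dx.
rewrite -expRM_natl ler_expR.
have -> : expR (3 / 2 * l - 1) = rho^-1 by rewrite /rho -expRN opprB.
have : p / 2 * (2 * (p * rho))^-1 = rho^-1 / 4.
  by field; rewrite !gt_eqF.
have : p / 2 * (2 * (p * rho))^-1 <= p / 2 * (M%:R + 1).
  by rewrite ler_wpM2l ?divr_ge0 1?ltW.
move: (p) (M%:R) (rho^-1) ((2 * (p * rho))^-1) p1 => {T MM M2 M1 pr0} *; lra.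
Qed.

End ProfileTail.

(** * Colourings *)

Section Colouring.
Variables (k n : nat) (t : 'I_n -> 'I_k) (w : {ffun 'I_n * 'I_n -> bool}).

Definition proper_on (A : {set 'I_n}) (c : 'I_n -> nat) :=
  forall x y, x \in A -> y \in A -> (x < y)%N -> w (x, y) -> c x <> c y.

Definition conf_colorable (m : nat) :=
  exists2 c : 'I_n -> nat, proper_on [set: 'I_n]%SET c & forall x, (c x < m)%N.

Lemma type_countU (A B : {set 'I_n}) i : [disjoint A & B] ->
  type_count t (A :|: B) i = (type_count t A i + type_count t B i)%N.
Proof.
move=> AB; rewrite /type_count -cardsUI.
rewrite (_ : #|_ :&: _| = 0%N) ?addn0.
  by apply: eq_card => x; rewrite !inE andb_orl.
apply/eqP; rewrite cards_eq0 finset.setI_eq0; apply/pred0P => x /=; rewrite !inE.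
by apply/negP => /andP[/andP[xA _] /andP[xB _]]; move/pred0P: AB => /(_ x) /=; rewrite xA xB.
Qed.

Lemma independent_absent (S : {set 'I_n}) x y : absent (edges S) w ->
  x \in S -> y \in S -> (x < y)%N -> w (x, y) = false.
Proof.
by move=> /forall_inP aS xS yS xy; apply/negbTE/aS; rewrite inE /= xS yS.
Qed.

Variable u : nat.
(** Types that are nearly exhausted in [U] are dropped from the demand; a subprofile of a sparse
    profile is still sparse, so the extraction never stalls. *)
Definition restricted (q : 'I_k -> nat) (U : {set 'I_n}) (i : 'I_k) : nat :=
  if (u <= type_count t U i)%N then q i else 0%N.

(** Each entry of [qs] removes one independent set from [U] and gives it the new colour [size qs].
    The invariant is per type: either fewer than [u] vertices are left, or every demand so far was
    met in full. *)
Lemma extraction (qs : seq ('I_k -> nat)) :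
  (forall q, List.In q qs -> forall U, has_profile t (restricted q U) U w) ->
  exists (U : {set 'I_n}) (c : 'I_n -> nat),
    [/\ proper_on (~: U)%SET c, forall x, x \notin U -> (c x < size qs)%N &
      forall i, (type_count t U i < u)%N \/
        (type_count t U i + \sum_(q <- qs) q i <= type_count t [set: 'I_n]%SET i)%N].
Proof.
elim: qs => [|q qs IH] H.
  exists [set: 'I_n]%SET, (fun=> 0%N); split.
  - by move=> x y; rewrite !inE.
  - by move=> x; rewrite inE.
  - by move=> i; right; rewrite big_nil addn0.
have [|U [c [cP cs cU]]] := IH.
  by move=> q' q'qs; apply: H; right.
have /existsP[S /and3P[SU /forallP Sq aS]] := H q (or_introl erefl) U.
exists (U :\: S)%SET, (fun x => if x \in S then size qs else c x); split.
- move=> x y; rewrite !inE !negb_and !negbK => xA yA xy wxy.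
  case: ifP => xS; case: ifP => yS.
  + by rewrite (independent_absent aS xS yS xy) in wxy.
  + move: yA; rewrite yS /= => /cs; case: ltngtP => // ? _; exact/eqP/negbT/gtn_eqF.
  + move: xA; rewrite xS /= => /cs; case: ltngtP => // ? _; exact/eqP/negbT/ltn_eqF.
  + by apply: cP => //; rewrite inE; [move: xA; rewrite xS|move: yA; rewrite yS].
- move=> x; rewrite !inE negb_and negbK; case: ifP => //= _ /cs; exact: ltnW.
- move=> i.
  have E : type_count t U i = (type_count t S i + type_count t (U :\: S)%SET i)%N.
    rewrite -type_countU; last first.
      by rewrite finset.disjoints_subset; apply/fintype.subsetP => x xS; rewrite !inE xS.
    congr type_count; apply/setP => x; rewrite !inE.
    by case: (boolP (x \in S)) => // /(fintype.subsetP SU) ->.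
  have [Uu|uU] := ltnP (type_count t U i) u.
    by left; apply: leq_ltn_trans Uu; rewrite E leq_addl.
  right; case: (cU i) => [|le]; first by rewrite ltnNge uU.
  move: (Sq i); rewrite /restricted uU => /eqP Si.
  by rewrite big_cons addnCA addnA -Si -E.
Qed.

(** A type whose demands were all met is used up, so at most [k * u] vertices remain; each gets a
    colour of its own, read off from its index in [enum U]. *)
Lemma extraction_colorable (qs : seq ('I_k -> nat)) :
  (forall q, List.In q qs -> forall U, has_profile t (restricted q U) U w) ->
  (forall i, type_count t [set: 'I_n]%SET i <= \sum_(q <- qs) q i)%N ->
  (0 < u)%N ->
  conf_colorable (size qs + k * u).
Proof.
move=> H Hq u0; have [U [c [cP cs cU]]] := extraction H.
have Uk : (#|U| <= k * u)%N.
  have -> : #|U| = (\sum_i type_count t U i)%N.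
    rewrite -sum1_card (partition_big t predT)//=; apply: eq_bigr => i _.
    by rewrite sum1_card; apply: eq_card => x; rewrite !inE.
  apply: (@leq_trans (\sum_(i < k) u)); last by rewrite sum_nat_const card_ord.
  apply: leq_sum => i _; case: (cU i) => [/ltnW//|le].
  have := leq_trans le (Hq i); rewrite -[X in (_ <= X)%N]add0n leq_add2r leqn0 => /eqP ->.
  by [].
exists (fun x => if x \in U then (size qs + index x (enum U))%N else c x).
  move=> x y _ _ xy wxy; case: ifP => xU; case: ifP => yU.
  - move=> /addnI /(congr1 (nth x (enum U))); rewrite !nth_index ?mem_enum// => xyE.
    by rewrite xyE ltnn in xy.
  - move=> E; have := cs y; rewrite yU -E => /(_ isT).
    by rewrite ltnNge leq_addr.
  - move=> E; have := cs x; rewrite xU E => /(_ isT).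
    by rewrite ltnNge leq_addr.
  - by apply: cP => //; rewrite inE ?xU ?yU.
move=> x; case: ifP => xU.
  by rewrite ltn_add2l (leq_trans _ Uk)// cardE index_mem mem_enum.
by apply: (leq_trans (cs x (negbT xU))); rewrite leq_addr.
Qed.

End Colouring.

Local Open Scope classical_set_scope.
Local Open Scope ring_scope.

Section ColourBounds.
Variables (R : realType) (k n : nat) (a : 'I_k -> 'I_k -> R) (t : 'I_n -> 'I_k)
  (w : {ffun 'I_n * 'I_n -> bool}).
Hypothesis a_ge0 : forall i j, 0 <= a i j.
Hypothesis a_sym : forall i j, a i j = a j i.
Variables (L : R) (aL : forall i j, a i j <= L).

Definition colour_class (m : nat) (col : 'I_n -> nat) (c : 'I_m) : {set 'I_n} :=
  [set x | col x == c]%SET.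

(** The condition at [J] comes from the vertices of [S] with type in [J], again an independent set.
    Doubling its energy bound gives [2 * e], and the diagonal in [energyE] costs at most [L] per
    vertex. *)
Lemma sparse_independent (S : {set 'I_n}) (e : R) : absent (edges S) w ->
  (forall U : {set 'I_n}, U != finset.set0 -> absent (edges U) w ->
     energy a t U <= e * #|U|%:R) ->
  sparse a (2 * e + L) (fun i => (type_count t S i)%:R).
Proof.
move=> aS H J; pose U := [set x in S | t x \in J]%SET.
have aU : absent (edges U) w.
  apply/forall_inP => x; rewrite !inE => /and3P[/andP[xS _] /andP[yS _] xy].
  by move/forall_inP: aS; apply; rewrite inE xS yS.
have UE i : type_count t U i = if i \in J then type_count t S i else 0%N.
  rewrite /type_count; case: ifP => iJ.
    by apply: eq_card => x; rewrite !inE; case: eqP => [->|]; rewrite ?iJ ?andbT ?andbF.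
  apply/eqP; rewrite cards_eq0; apply/eqP/setP => x; rewrite !inE.
  by case: eqP => [->|]; rewrite ?iJ ?andbF.
have sumU (f : 'I_k -> R) :
    \sum_i f i * (type_count t U i)%:R = \sum_(i in J) f i * (type_count t S i)%:R.
  rewrite [RHS]big_mkcond; apply: eq_bigr => i _; rewrite UE; case: ifP => //.
  by rewrite mulr0.
have cardU : #|U|%:R = \sum_(i in J) (type_count t S i)%:R :> R.
  rewrite (card_type_count _ t) [RHS]big_mkcond; apply: eq_bigr => i _.
  by rewrite UE; case: ifP.
have quadU : quad a (fun i => (type_count t S i)%:R) J =
    \sum_i \sum_j a i j * (type_count t U i)%:R * (type_count t U j)%:R.
  rewrite /quad big_mkcond; apply: eq_bigr => i _; rewrite (sumU (fun j => a i j * _)) UE.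
  by case: ifP => // _; rewrite big1// => j _; rewrite mulr0 mul0r.
have diag : \sum_i a i i * (type_count t U i)%:R <= L * \sum_(i in J) (type_count t S i)%:R.
  by rewrite sumU mulr_sumr ler_sum// => i _; rewrite ler_wpM2r// ler0n.
have EU : energy a t U <= e * \sum_(i in J) (type_count t S i)%:R.
  have [U0|U0] := eqVneq U finset.set0; last by rewrite -cardU H.
  by rewrite -cardU U0 cards0 mulr0 /energy edges_small ?cards0// big_set0.
have := energyE t a_sym U; rewrite -quadU.
move: diag EU; set D := \sum_i _; set Z := \sum_(i in J) _.
set q := quad _ _ _; set E := energy _ _ _; move=> dg EZ H2.
rewrite mulrDl -mulrA; lra.
Qed.

Variables (s : 'I_k -> R) (F : R).
Hypothesis F_lower : forall m (v : 'I_m -> 'I_k -> R) (g K : R),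
  (forall c i, 0 <= v c i) -> 0 <= g -> (forall c, sparse a g (v c)) -> 0 <= K ->
  (forall i, K * s i <= \sum_c v c i) -> K * F <= m%:R * g.

(** The profiles of the colour classes are fed into [F_lower], the finite-dimensional form of the
    lower bound on [varphi_k], which [varphi_k_lower] supplies. *)
Lemma colours_ge (m : nat) (e K : R) : 0 <= 2 * e + L -> 0 <= K ->
  (forall U : {set 'I_n}, U != finset.set0 -> absent (edges U) w ->
     energy a t U <= e * #|U|%:R) ->
  (forall i, K * s i <= (type_count t [set: 'I_n]%SET i)%:R) ->
  conf_colorable w m -> K * F <= m%:R * (2 * e + L).
Proof.
move=> eL K0 H Ks [col proper_col colm].
apply: (F_lower (v := fun c i => (type_count t (colour_class col c) i)%:R)) => //.
  move=> c; apply: sparse_independent => //; apply/forall_inP => -[x y]; rewrite !inE /=.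
  move=> /and3P[/eqP cx /eqP cy xy]; apply/negP => wxy.
  by apply: (proper_col x y); rewrite ?inE// cx cy.
move=> i; apply: le_trans (Ks i) _; rewrite -natr_sum ler_nat.
rewrite {1}/type_count -sum1_card (partition_big (fun x => Ordinal (colm x)) xpredT)//=.
apply: leq_sum => c _; rewrite sum1_card; apply: subset_leq_card.
apply/fintype.subsetP => x; rewrite unfold_in => /andP[] /[!inE] /= -> /eqP <-.
by rewrite eqxx.
Qed.

Variables (m0 : nat) (q : 'I_m0 -> 'I_k -> nat) (J : 'I_m0 -> nat) (u : nat).

Lemma colours_le : (0 < u)%N ->
  (forall c U, has_profile t (restricted t u (q c) U) U w) ->
  (forall i, type_count t [set: 'I_n]%SET i <= \sum_c J c * q c i)%N ->
  conf_colorable w (\sum_c J c + k * u).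
Proof.
move=> u0 H Hq; pose qs := flatten [seq nseq (J c) (q c) | c <- enum 'I_m0].
have sqs : size qs = (\sum_c J c)%N.
  rewrite size_flatten /shape -map_comp sumnE big_map big_enum /=.
  by apply: eq_bigr => c _; rewrite size_nseq.
rewrite -sqs; apply: (extraction_colorable (t := t)) => //.
  move=> p; rewrite /qs; elim: (enum 'I_m0) => //= c l IH.
  by elim: (J c) => [|j IHj] //= [<-|/IHj].
move=> i; apply: leq_trans (Hq i) _; rewrite /qs big_flatten big_map big_enum /=.
by apply: leq_sum => c _; rewrite big_nseq iter_addn_0 mulnC.
Qed.

End ColourBounds.

(** * The chromatic number read off the edge configuration *)

Section ChromaticNumber.
Variable (n : nat).
Implicit Types (H : simple_graph 'I_n).

Lemma colorable_conf H m :
  colorable H m <-> conf_colorable [ffun e : 'I_n * 'I_n => adj H e.1 e.2 && (e.1 < e.2)%N] m.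
Proof.
split.
  move=> /existsP[c /forallP cP]; exists (fun x => val (c x)) => [x y _ _ xy|x];
    last exact: ltn_ord.
  rewrite ffunE /= xy andbT => Hxy /val_inj E.
  by move/forallP: (cP x) => /(_ y); rewrite Hxy E eqxx.
move=> [c cP cm]; apply/existsP; exists [ffun x => Ordinal (cm x)].
apply/forallP => x; apply/forallP => y; apply/implyP => Hxy; rewrite !ffunE -val_eqE /=.
apply/eqP; case: (ltngtP x y) => [xy|yx|/val_inj E].
- by apply: cP; rewrite ?inE// ffunE /= xy Hxy.
- by apply/nesym; apply: cP; rewrite ?inE// ffunE /= yx adj_sym Hxy.
- by move: Hxy; rewrite E adj_irr.
Qed.

Lemma chromatic_number_le H m :
  conf_colorable [ffun e : 'I_n * 'I_n => adj H e.1 e.2 && (e.1 < e.2)%N] m ->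
  (chromatic_number H <= m)%N.
Proof.
by move=> /colorable_conf Hm; rewrite /chromatic_number; case: ex_minnP => c _; apply.
Qed.

Lemma chromatic_number_colorable H :
  conf_colorable [ffun e : 'I_n * 'I_n => adj H e.1 e.2 && (e.1 < e.2)%N]
    (chromatic_number H).
Proof. by apply/colorable_conf; rewrite /chromatic_number; case: ex_minnP. Qed.

End ChromaticNumber.

(** * The block structure of the variational problem *)

Section BlockPartition.
Variables (R : realType) (k : nat) (S : 'I_k -> set R).
Hypothesis S_meas : forall i, measurable (S i).
Hypothesis S_cover : \bigcup_i S i = `[0, 1]%classic.
Hypothesis S_triv : trivIset setT S.

Lemma block_sub01 i : S i `<=` `[0, 1].
Proof. by rewrite -S_cover; apply: bigcup_sup. Qed.

Lemma block_uniq i j x : S i x -> S j x -> i = j.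
Proof. by move=> Si Sj; apply: (S_triv (i := i) (j := j)) => //; exists x. Qed.

Lemma block_exists x : x \in `[0, 1] -> exists i, S i x.
Proof.
move=> x01; have : (`[0, 1]%classic : set R) x by [].
by rewrite -S_cover => -[i _ Six]; exists i.
Qed.

Variables (mu : probability (measurableTypeR R) R).

Implicit Types A : set R.
Definition block_mass (A : set R) (i : 'I_k) : R := fine (mu (A `&` S i)).

Lemma block_massE A i : measurable A -> (block_mass A i)%:E = mu (A `&` S i).
Proof. by move=> mA; rewrite fineK// fin_num_measure//; apply: measurableI => //; exact: S_meas. Qed.

Lemma block_mass_ge0 A i : 0 <= block_mass A i.
Proof. by rewrite fine_ge0 ?measure_ge0. Qed.

Lemma measure_blocks A : measurable A -> A `<=` `[0, 1] ->
  mu A = (\sum_i block_mass A i)%:E.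
Proof.
move=> mA A01; rewrite -sumEFin; under eq_bigr do rewrite block_massE//.
rewrite -(measure_bigsetU_ord mu xpredT (F := fun i => A `&` S i)); last 2 first.
- by move=> i; apply: measurableI => //; exact: S_meas.
- by move=> i j _ _ [x [[_ Si] [_ Sj]]]; exact: block_uniq Si Sj.
congr (mu _); rewrite -bigcup_seq_cond; apply/seteqP; split=> x.
  move=> Ax; have [|i Six] := @block_exists x; first by have := A01 _ Ax.
  by exists i => //=; rewrite mem_index_enum.
by move=> [i _ []].
Qed.

Variables (W : R -> R -> R) (a : 'I_k -> 'I_k -> R).
Hypothesis a_ge0 : forall i j, 0 <= a i j.
Hypothesis WE : forall i j x y, S i x -> S j y -> 1 - W x y = expR (- a i j).

Lemma lne_block i j x y : S i x -> S j y -> lne ((1 - W x y)%:E^-1)%E = (a i j)%:E.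
Proof.
move=> Sx Sy; rewrite (WE Sx Sy) inver gt_eqF ?expR_gt0// expRN invrK.
by rewrite lne_EFin ?expR_gt0// expRK.
Qed.

Lemma block_integral (A : set R) (c : 'I_k -> R) (f : R -> \bar R) :
  measurable A -> A `<=` `[0, 1] -> (forall i, 0 <= c i) ->
  (forall i x, A x -> S i x -> f x = (c i)%:E) ->
  (\int[mu]_(x in A) f x = (\sum_i c i * block_mass A i)%:E)%E.
Proof.
move=> mA A01 c0 fc.
have mind i : measurable_fun A (fun x : measurableTypeR R => (\1_(S i) x)%:E).
  by apply/measurable_EFinP; apply: measurable_indic; exact: S_meas.
transitivity (\int[mu]_(x in A) \sum_(i < k) ((c i)%:E * (\1_(S i) x)%:E))%E.
  apply: eq_integral => x /set_mem Ax.
  have [|i Six] := @block_exists x; first by have := A01 _ Ax.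
  rewrite (fc i)// (bigD1 i)//= big1 ?adde0 => [|j ji].
    by rewrite indicE mem_set// mule1.
  rewrite indicE memNset ?mule0// => Sjx.
  by move: ji; rewrite (block_uniq Sjx Six) eqxx.
rewrite ge0_integral_sum//; last 2 first.
- by move=> i; apply: emeasurable_funM => //; exact: mind.
- by move=> i x _; rewrite lee_fin mulr_ge0// indicE.
rewrite -sumEFin; apply: eq_bigr => i _.
rewrite ge0_integralZl_EFin//; last exact: mind.
rewrite EFinM block_massE//; congr (_ * _)%E; rewrite setIC.
apply: integral_indic => //; exact: S_meas.
Qed.

Lemma varphi_value (A : set R) : measurable A -> A `<=` `[0, 1] ->
  (\int[mu]_(y in A) \int[mu]_(x in A) lne ((1 - W x y)%:E^-1) =
   (\sum_j (\sum_i a i j * block_mass A i) * block_mass A j)%:E)%E.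
Proof.
move=> mA A01; apply: block_integral => //.
  by move=> j; apply: sumr_ge0 => i _; rewrite mulr_ge0 ?block_mass_ge0.
move=> j y Ay Sjy; apply: block_integral => // i x Ax Six.
exact: lne_block.
Qed.

Local Notation I01 := (`[0, 1]%classic : set R).
Hypothesis mu01 : mu I01 = 1%E.
Local Notation mass := (block_mass I01).

Lemma massE i : (mass i)%:E = mu (S i).
Proof. by rewrite block_massE// setIidr//; exact: block_sub01. Qed.

Lemma sum_mass : \sum_i mass i = 1.
Proof. by apply/EFin_inj; rewrite -measure_blocks. Qed.

Lemma quadE (x : 'I_k -> R) :
  quad a x [set: 'I_k]%SET = \sum_j (\sum_i a i j * x i) * x j.
Proof.
rewrite /quad exchange_big /=; under eq_bigl do rewrite inE.
apply: eq_bigr => j _; under eq_bigl do rewrite inE.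
by rewrite mulr_suml.
Qed.

(** A measurable set enters only through its block masses, a point of the box below [mass], to which
    [sparse_box] applies. *)
Lemma varphi_le (c : R) : 0 <= c -> sparse a c mass -> (varphi mu W <= c%:E)%E.
Proof.
move=> c0 sp; apply: ge_ereal_sup => _ [A [mA A01 A0] <-].
have yx i : 0 <= block_mass A i <= mass i.
  rewrite block_mass_ge0/= -lee_fin !block_massE//.
  apply: le_measure; [apply: mem_set|apply: mem_set|exact: setSI];
    by apply: measurableI => //; exact: S_meas.
have := sparse_box a_ge0 sp yx.
rewrite varphi_value// quadE measure_blocks// in A0 *.
move: A0; rewrite lte_fin => A0 H.
rewrite inver gt_eqF// -EFinM lee_fin mulrC ler_pdivrMr//.
Qed.

(** The condition at [J] is tested on the union of the blocks in [J]. If that union is null, the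
    supremum does not see it, but then both sides of the condition vanish. *)
Lemma sparse_varphi (c : R) : (varphi mu W <= c%:E)%E -> sparse a c mass.
Proof.
move=> vc J; pose A := \bigcup_(i in [set` J]) S i.
have mA : measurable A.
  by rewrite /A bigcup_mkcond; apply: fin_bigcup_measurable => // i _; case: ifP.
have A01 : A `<=` `[0, 1] by apply: bigcup_sub => i _; exact: block_sub01.
have massA i : block_mass A i = if i \in J then mass i else 0.
  case: ifP => iJ.
    rewrite /block_mass; congr (fine (mu _)); apply/seteqP; split => x [_ Six]; split => //.
      exact: block_sub01 Six.
    by exists i.
  rewrite /block_mass (_ : A `&` S i = set0) ?measure0//.
  apply/seteqP; split => // x [[j jJ Sjx] Six].
  by move: jJ; rewrite /= (block_uniq Sjx Six) iJ.
have sumA : \sum_i block_mass A i = \sum_(i in J) mass i.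
  by rewrite [RHS]big_mkcond; apply: eq_bigr.
have quadA : \sum_j (\sum_i a i j * block_mass A i) * block_mass A j = quad a mass J.
  rewrite /quad exchange_big /= [RHS]big_mkcond; apply: eq_bigr => j _.
  rewrite massA; case: ifP => _; last by rewrite mulr0.
  rewrite mulr_suml [RHS]big_mkcond; apply: eq_bigr => i _; rewrite massA.
  by case: ifP => _; rewrite ?mulr0 ?mul0r//; ring.
have [A0|A0] := ltP 0 (\sum_(i in J) mass i); last first.
  have m0 i : i \in J -> mass i = 0.
    have S0 : \sum_(i in J) mass i = 0.
      by apply/eqP; rewrite eq_le A0 sumr_ge0// => j _; exact: block_mass_ge0.
    by move: i; apply: psumr_eq0P S0 => j _; exact: block_mass_ge0.
  rewrite /quad big1 => [|i iJ]; first by rewrite big1 ?mulr0.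
  by rewrite big1// => j _; rewrite m0// mulr0 mul0r.
have muA : mu A = (\sum_(i in J) mass i)%:E by rewrite measure_blocks// sumA.
have : ((mu A)^-1 * \int[mu]_(y in A) \int[mu]_(x in A) lne ((1 - W x y)%:E^-1) <= c%:E)%E.
  apply: le_trans vc; apply: ereal_sup_ubound; exists A => //; split => //.
  by rewrite muA lte_fin.
rewrite varphi_value// quadA muA inver gt_eqF// -EFinM lee_fin mulrC.
by rewrite ler_pdivrMr.
Qed.

Lemma varphi_ge0 : (0 <= varphi mu W)%E.
Proof.
have m01 : measurable (`[0, 1]%classic : set R) by [].
have v0 : (0 <= (mu I01)^-1 *
   \int[mu]_(y in I01) \int[mu]_(x in I01) lne ((1 - W x y)%:E^-1))%E.
  rewrite varphi_value// mu01 inve1 mul1e lee_fin sumr_ge0// => j _.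
  by rewrite mulr_ge0 ?block_mass_ge0// sumr_ge0// => i _; rewrite mulr_ge0 ?block_mass_ge0.
apply: le_trans v0 _; apply: ereal_sup_ubound; exists I01 => //; split => //.
by rewrite mu01 lte01.
Qed.

Lemma varphi_bounded (L : R) : (forall i j, a i j <= L) -> 0 <= L -> (varphi mu W <= L%:E)%E.
Proof.
move=> aL L0; apply: varphi_le => // J.
apply: (@le_trans _ _ (L * ((\sum_(i in J) mass i) * (\sum_(j in J) mass j)))).
  rewrite /quad big_distrlr /= mulr_sumr ler_sum// => i _.
  rewrite mulr_sumr ler_sum// => j _; rewrite -mulrA.
  by rewrite ler_wpM2r ?mulr_ge0 ?block_mass_ge0.
have J1 : \sum_(i in J) mass i <= 1.
  rewrite -[leRHS]sum_mass [leRHS](bigID (mem J)) /= lerDl sumr_ge0// => i _.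
  exact: block_mass_ge0.
rewrite ler_wpM2l// -[leRHS]mul1r ler_wpM2r// sumr_ge0// => i _.
exact: block_mass_ge0.
Qed.

Lemma varphi_fin (L : R) : (forall i j, a i j <= L) -> 0 <= L ->
  varphi mu W = (fine (varphi mu W))%:E.
Proof.
move=> aL L0; rewrite fineK// ge0_fin_numE ?varphi_ge0//.
by apply: le_lt_trans (varphi_bounded aL L0) _; rewrite ltry.
Qed.

End BlockPartition.

Lemma unif01_itv (R : realType) : unif01 R (`[0, 1]%classic : set R) = 1%E.
Proof. exact: integral_uniform_pdf1. Qed.

Lemma unif01_setI (R : realType) (A : set R) :
  unif01 R (A `&` `[0, 1]%classic) = unif01 R A.
Proof.
rewrite /unif01 /= /uniform_prob [RHS]integral_uniform_pdf.
by rewrite [LHS]integral_uniform_pdf -setIA setIid.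
Qed.

(** * Probability measures with constant density on each block *)

Section Mixture.
Variables (R : realType) (k : nat) (S : 'I_k -> set R).
Hypothesis S_meas : forall i, measurable (S i).
Variable c : 'I_k -> {nonneg R}.

(** [msum] takes a sequence of measures indexed by [nat]; [insub] identifies its first [k] indices
    with the blocks. *)
Let part (j : nat) : {measure set (measurableTypeR R) -> \bar R} :=
  if insub j is Some i then mscale (c i) (mrestr (unif01 R) (S_meas i)) else mzero.

Definition mixture : set (measurableTypeR R) -> \bar R := msum part k.

HB.instance Definition _ := Measure.on mixture.

Lemma mixtureE A : mixture A = (\sum_i (c i)%:num%:E * unif01 R (A `&` S i))%E.
Proof. by rewrite /mixture /msum; apply: eq_bigr => i _; rewrite /part valK. Qed.

Hypothesis c1 : (\sum_i (c i)%:num%:E * unif01 R (S i) = 1)%E.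

Lemma mixture_setT : mixture [set: _] = 1%E.
Proof. by rewrite mixtureE; under eq_bigr do rewrite setTI. Qed.

Definition mixture_prob : probability (measurableTypeR R) R :=
  HB.pack mixture (Measure_isProbability.Build _ _ _ mixture mixture_setT).

Lemma mixture_probE A :
  mixture_prob A = (\sum_i (c i)%:num%:E * unif01 R (A `&` S i))%E.
Proof. exact: mixtureE. Qed.

End Mixture.

Section FiniteFamily.
Variables (R : realType) (m : nat) (nu : 'I_m -> probability (measurableTypeR R) R)
  (b : 'I_m -> R).
Hypothesis b_ge0 : forall c, 0 <= b c.

(* The measures nu c need not be distinct: the weights of equal ones are added. *)
Definition family_weight (mu : probability (measurableTypeR R) R) : R :=
  \sum_(c | nu c == mu) b c.

Lemma finite_family : finite_set (range nu).
Proof. exact/finite_image/finite_finset. Qed.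

Lemma sum_family (f : probability (measurableTypeR R) R -> \bar R) :
  (\sum_(mu \in range nu) (family_weight mu)%:E * f mu = \sum_c (b c)%:E * f (nu c))%E.
Proof.
rewrite fsbig_finite; last exact: finite_family.
under eq_bigr => mu _.
  rewrite -sumEFin ge0_sume_distrl; last by move=> c _; rewrite lee_fin.
  over.
rewrite (exchange_big_dep xpredT)//=; apply: eq_bigr => c _.
have cin : nu c \in fset_set (range nu).
  by rewrite in_fset_set; [apply: mem_set; exists c|exact: finite_family].
rewrite big_mkcond (bigD1_seq (nu c)) ?fset_uniq// eqxx big1; first exact: adde0.
by move=> mu; rewrite eq_sym => /negbTE ->.
Qed.

Lemma sum_family_weight (F : probability (measurableTypeR R) R -> R) :
  \sum_(mu \in range nu) family_weight mu * F mu = \sum_c b c * F (nu c).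
Proof.
apply/EFin_inj; have fin := finite_family.
rewrite fsbig_finite// -[in RHS]sumEFin -sumEFin.
by have := @sum_family (fun mu => (F mu)%:E); rewrite fsbig_finite.
Qed.

Lemma varphi_k_le_family (k : nat) (W : R -> R -> R) : (m <= k)%N ->
  \sum_c b c = 1 -> (forall c, nu c (`[0, 1]%classic : set R) = 1%E) ->
  (forall A : set R, measurable A -> (\sum_c (b c)%:E * nu c A = unif01 R A)%E) ->
  (varphi_k k W <= \sum_c (b c)%:E * varphi (nu c) W)%E.
Proof.
move=> mk b1 nu01 nuA; apply: ereal_inf_lbound.
exists (range nu), family_weight; split; last by rewrite sum_family.
  split.
  - split; first exact: finite_family.
    by move=> _ [c _ <-].
  - move=> mu _; rewrite /family_weight sumr_ge0//= -b1.
    by rewrite [leRHS](bigID (fun c => nu c == mu))/= lerDl sumr_ge0.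
  - have := @sum_family_weight (fun=> 1).
    under [in RHS]eq_bigr do rewrite mulr1.
    rewrite b1 => <-; apply: eq_fsbigr => mu _; by rewrite mulr1.
  - by move=> A mA; rewrite sum_family// nuA.
apply: card_le_trans (card_image_le nu [set: 'I_m]) _.
have f_inj : injective (fun c : 'I_m => nat_of_ord c) by exact: ord_inj.
apply: (@card_le_trans _ _ _ `I_m); last by rewrite card_le_II.
have : ((fun c : 'I_m => nat_of_ord c) @` [set: 'I_m] #= [set: 'I_m])%card.
  by apply: inj_card_eq => i j _ _; exact: f_inj.
move=> /card_eqPle[_ le1]; apply: (card_le_trans le1).
by apply: subset_card_le => _ [c _ <-] /=.
Qed.

End FiniteFamily.

(** * The functional [varphi_k] as a cost of sparse decompositions of the block sizes *)

Section PhiBounds.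
Variables (R : realType) (k : nat) (S : 'I_k -> set R).
Hypothesis S_meas : forall i, measurable (S i).
Hypothesis S_cover : \bigcup_i S i = `[0, 1]%classic.
Hypothesis S_triv : trivIset setT S.
Variables (W : R -> R -> R) (a : 'I_k -> 'I_k -> R).
Hypothesis a_ge0 : forall i j, 0 <= a i j.
Hypothesis WE : forall i j x y, S i x -> S j y -> 1 - W x y = expR (- a i j).

Local Notation I01 := (`[0, 1]%classic : set R).
Local Notation bmass := (block_mass S).
Definition block_size : 'I_k -> R := bmass (unif01 R) I01.

Lemma block_sizeE i : (block_size i)%:E = unif01 R (S i).
Proof. exact: massE. Qed.

Lemma block_size_ge0 i : 0 <= block_size i.
Proof. exact: block_mass_ge0. Qed.

Lemma sum_block_size : \sum_i block_size i = 1.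
Proof. by apply: sum_mass => //; exact: unif01_itv. Qed.

Lemma unif01_blocks (A : set R) : measurable A ->
  unif01 R A = (\sum_i unif01 R (A `&` S i))%E.
Proof.
move=> mA; rewrite -unif01_setI (measure_blocks S_meas S_cover S_triv); last 2 first.
- exact: measurableI.
- exact: subIsetr.
rewrite -sumEFin; apply: eq_bigr => i _; rewrite block_massE//; last exact: measurableI.
by rewrite -setIA (setIidr (block_sub01 S_cover (i := i))).
Qed.

(** With [b] the total of [x], the measure [nu] has density [x i / (b * block_size i)] on block [i];
    null blocks cannot be charged, hence the third hypothesis. Scaling the profile by [b^-1] scales
    its cost likewise. For [x = 0] any measure serves, since its weight is 0. *)
Lemma profile_measure (x : 'I_k -> R) (g : R) : (forall i, 0 <= x i) -> 0 <= g ->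
  (forall i, block_size i = 0 -> x i = 0) -> sparse a g x ->
  exists nu : probability (measurableTypeR R) R,
    [/\ nu I01 = 1%E,
        forall A : set R, measurable A -> ((\sum_i x i)%:E * nu A =
          \sum_i (x i / block_size i)%:E * unif01 R (A `&` S i))%E &
        ((\sum_i x i)%:E * varphi nu W <= g%:E)%E].
Proof.
move=> x0 g0 xs0 sx.
pose b := \sum_i x i.
have [b0|b0] := leP b 0.
  have xE i : x i = 0.
    have S0 : \sum_i x i = 0 by apply/le_anti/andP; split => //; apply: sumr_ge0.
    exact: (psumr_eq0P (fun i _ => x0 i) S0).
  have -> : \sum_i x i = 0 by rewrite big1.
  exists (unif01 R); split; first exact: unif01_itv.
    by move=> A mA; rewrite mul0e big1// => i _; rewrite xE mul0r mul0e.
  by rewrite mul0e lee_fin.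
have r0 i : 0 <= b^-1 * (x i / block_size i).
  by apply: mulr_ge0; [rewrite invr_ge0 ltW|rewrite divr_ge0// block_size_ge0].
pose r i := NngNum (r0 i).
have rs i : (r i)%:num * block_size i = b^-1 * x i.
  rewrite /=; have [s0|s0] := eqVneq (block_size i) 0; last by rewrite -mulrA divfK.
  by rewrite s0 xs0// !mulr0.
have r1 : (\sum_i (r i)%:num%:E * unif01 R (S i) = 1)%E.
  under eq_bigr do rewrite -block_sizeE -EFinM rs.
  by rewrite sumEFin -mulr_sumr mulVf// gt_eqF.
pose nu := mixture_prob S_meas r1.
have nuE A : nu A = (\sum_i (r i)%:num%:E * unif01 R (A `&` S i))%E.
  exact: mixture_probE.
have nu01 : nu I01 = 1%E.
  rewrite nuE -r1; apply: eq_bigr => i _; rewrite setIidr//; exact: block_sub01.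
exists nu; split => //.
  move=> A mA; rewrite nuE ge0_sume_distrr; last first.
    by move=> i _; rewrite mule_ge0 ?measure_ge0// lee_fin.
  apply: eq_bigr => i _; rewrite muleA -EFinM; congr (_%:E * _)%E.
  by rewrite /= mulrA mulfV ?mul1r// gt_eqF.
have nuS i : block_mass S nu I01 i = b^-1 * x i.
  apply/EFin_inj; rewrite massE// nuE (bigD1 i)//= setIid big1 ?adde0.
    by rewrite -block_sizeE -EFinM rs.
  move=> j ji; rewrite (_ : S i `&` S j = set0) ?measure0 ?mule0//.
  apply/seteqP; split=> // y [Siy Sjy].
  by move: ji; rewrite (block_uniq S_triv Siy Sjy) eqxx.
have : (varphi nu W <= (b^-1 * g)%:E)%E.
  apply: (varphi_le S_meas S_cover S_triv a_ge0 WE).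
    by rewrite mulr_ge0// invr_ge0 ltW.
  rewrite (_ : block_mass S nu I01 = fun i => b^-1 * x i); last exact/funext.
  by apply: sparseZ => //; rewrite invr_ge0 ltW.
rewrite -(@lee_pmul2l _ b%:E)// => /le_trans; apply.
by rewrite -EFinM mulrA mulfV ?mul1r// gt_eqF.
Qed.

Lemma varphi_k_le (m : nat) (x : 'I_m -> 'I_k -> R) (g : 'I_m -> R) : (m <= k)%N ->
  (forall c i, 0 <= x c i) -> (forall c, 0 <= g c) -> (forall c, sparse a (g c) (x c)) ->
  (forall i, \sum_c x c i = block_size i) ->
  (varphi_k k W <= (\sum_c g c)%:E)%E.
Proof.
move=> mk x0 g0 sx xs.
have xs0 c i : block_size i = 0 -> x c i = 0.
  by rewrite -xs => S0; exact: (psumr_eq0P (fun c' _ => x0 c' i) S0).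
have /choice[nu nuP] c := profile_measure (x0 c) (g0 c) (xs0 c) (sx c).
pose b c := \sum_i x c i.
apply: (@le_trans _ _ (\sum_c (b c)%:E * varphi (nu c) W)%E); last first.
  rewrite -sumEFin; apply: lee_sum => c _; by have [] := nuP c.
apply: varphi_k_le_family => //.
- by move=> c; apply: sumr_ge0.
- by rewrite exchange_big /= -sum_block_size; apply: eq_bigr => i _; rewrite xs.
- by move=> c; have [] := nuP c.
- move=> A mA; rewrite (eq_bigr (fun c => \sum_i (x c i / block_size i)%:E *
      unif01 R (A `&` S i))%E); last first.
    by move=> c _; have [_ /(_ _ mA)] := nuP c.
  rewrite exchange_big /= unif01_blocks//; apply: eq_bigr => i _.
  rewrite -ge0_sume_distrl; last first.
    by move=> c _; rewrite lee_fin divr_ge0// block_size_ge0.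
  (* For a null block the quotient takes the default value 0, and the uniform measure of its part in
     [A] is 0 as well. *)
  rewrite sumEFin -mulr_suml xs; have [s0|s0] := eqVneq (block_size i) 0.
    rewrite s0 mul0r mul0e; apply/esym/eqP; rewrite eq_le measure_ge0 andbT.
    have <- : unif01 R (S i) = 0%E by rewrite -block_sizeE s0.
    apply: le_measure; [apply: mem_set|apply: mem_set|exact: subIsetr].
      by apply: measurableI => //; exact: S_meas.
    exact: S_meas.
  by rewrite mulfV// mul1e.
Qed.


Variables (L : R) (aL : forall i j, a i j <= L) (k_gt0 : (0 < k)%N).

Let L_ge0 : 0 <= L.
Proof. by apply: le_trans (aL (Ordinal k_gt0) (Ordinal k_gt0)). Qed.

Lemma varphi_k_fin : varphi_k k W = (fine (varphi_k k W))%:E.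
Proof.
rewrite fineK// ge0_fin_numE.
  apply: (@le_lt_trans _ _ (\sum_(c < 1) L)%:E); last exact: ltry.
  apply: (@varphi_k_le 1 (fun=> block_size) (fun=> L)) => //.
  - by move=> _; exact: block_size_ge0.
  - move=> _; apply: (sparse_varphi (mu := unif01 R) S_meas S_cover S_triv a_ge0 WE).
    by apply: (varphi_bounded S_meas S_cover S_triv a_ge0 WE) => //; exact: unif01_itv.
  - by move=> i; rewrite big_ord1.
apply: le_ereal_inf_tmp => _ [M [alpha [[[fM M01] al _ _] _ ->]]].
rewrite fsbig_finite//; rewrite big_seq sume_ge0// => mu.
rewrite in_fset_set// => /set_mem Mmu; rewrite mule_ge0//.
  by rewrite lee_fin; have /andP[] := al _ Mmu.
by apply: (varphi_ge0 S_meas S_cover S_triv a_ge0 WE); exact: M01.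
Qed.

Lemma varphi_k_ge (e : R) : 0 < e -> exists m (x : 'I_m -> 'I_k -> R) (g : 'I_m -> R),
  [/\ forall c i, 0 <= x c i, forall c, 0 <= g c, forall c, sparse a (g c) (x c),
      forall i, \sum_c x c i = block_size i &
      \sum_c g c <= fine (varphi_k k W) + e].
Proof.
move=> e0; have fin : varphi_k k W \is a fin_num by rewrite varphi_k_fin.
have [_ [M [alpha [[[fM M01] al _ lam] _ ->]]] vM] := lb_ereal_inf_adherent e0 fin.
pose r := enum_fset (fset_set M).
have rM mu : mu \in r -> M mu by rewrite /r in_fset_set// => /set_mem.
pose mu c := tnth (in_tuple r) c.
have muM c : M (mu c) by apply: rM; exact: mem_tnth.
exists (size r), (fun c i => alpha (mu c) * block_mass S (mu c) I01 i),
  (fun c => alpha (mu c) * fine (varphi (mu c) W)).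
have vfin c : varphi (mu c) W = (fine (varphi (mu c) W))%:E.
  by apply: (varphi_fin S_meas S_cover S_triv a_ge0 WE (M01 _ (muM c)) aL).
have a0 c : 0 <= alpha (mu c) by have /andP[] := al _ (muM c).
split.
- by move=> c i; rewrite mulr_ge0// block_mass_ge0.
- move=> c; rewrite mulr_ge0// fine_ge0//.
  by apply: (varphi_ge0 S_meas S_cover S_triv a_ge0 WE); exact: M01.
- move=> c; apply: sparseZ => //; apply: (sparse_varphi S_meas S_cover S_triv a_ge0 WE).
  by rewrite -vfin.
- move=> i; apply/EFin_inj; rewrite block_sizeE -lam; last exact: S_meas.
  rewrite fsbig_finite// -sumEFin -/r [RHS]big_tnth; apply: eq_bigr => c _.
  by rewrite EFinM massE.
rewrite -lee_fin EFinD -varphi_k_fin; apply/ltW; apply: le_lt_trans vM.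
rewrite fsbig_finite// -/r [leRHS]big_tnth -sumEFin; apply: lee_sum => c _.
by rewrite EFinM -vfin.
Qed.

(** Coordinate [i] of every [v c] is rescaled by [block_size i / N i], at most [1 / K], which turns
    a cover of [K] times the block sizes into an exact decomposition with common cost [g / K];
    [sparse_le] permits the unequal factors. Caratheodory then leaves at most [k] pieces of total
    weight at most [m], so the cost stays below [m * g / K]. *)
Lemma varphi_k_lower (m : nat) (v : 'I_m -> 'I_k -> R) (g K : R) :
  (forall c i, 0 <= v c i) -> 0 <= g -> (forall c, sparse a g (v c)) -> 0 <= K ->
  (forall i, K * block_size i <= \sum_c v c i) ->
  K * fine (varphi_k k W) <= m%:R * g.
Proof.
move=> v0 g0 sv; rewrite le_eqVlt => /predU1P[<- _|K0 Kv].
  by rewrite mul0r mulr_ge0.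
pose N i := \sum_c v c i.
have N0 i : 0 <= N i by apply: sumr_ge0.
have Ki0 : 0 <= K^-1 by rewrite invr_ge0 ltW.
pose x c i := v c i * (block_size i / N i).
have sN i : 0 <= block_size i / N i <= K^-1.
  rewrite divr_ge0 ?block_size_ge0//=; have [->|Ni0] := eqVneq (N i) 0.
    by rewrite invr0 mulr0.
  have Np : 0 < N i by rewrite lt_def Ni0 N0.
  by rewrite ler_pdivrMr// ler_pdivlMl.
have x_sum i : \sum_c x c i = block_size i.
  rewrite -mulr_suml -/(N i) mulrCA; have [Ni0|Ni0] := eqVneq (N i) 0; last first.
    by rewrite mulfV// mulr1.
  have := Kv i; rewrite -/(N i) Ni0 pmulr_rle0// => s0.
  have -> : block_size i = 0 by apply/le_anti; rewrite s0 block_size_ge0.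
  by rewrite mul0r.
have sx c : sparse a (K^-1 * g) (x c).
  apply: (sparse_le a_ge0 (sparseZ Ki0 (sv c))) => i; have /andP[h0 h1] := sN i.
  by rewrite mulr_ge0//= /x mulrC ler_wpM2r.
pose Q (y : 'I_k -> R) := (forall i, 0 <= y i) /\ sparse a (K^-1 * g) y.
have Qx c : Q (x c).
  by split=> // i; rewrite mulr_ge0//; have /andP[] := sN i.
have [m' [x' [b [m'k Qx' b0 E S1]]]] := conic_caratheodory Qx (fun=> ler01).
have le : (varphi_k k W <= (\sum_c b c * (K^-1 * g))%:E)%E.
  apply: (@varphi_k_le m' (fun c i => b c * x' c i)) => //.
  - by move=> c i; rewrite mulr_ge0//; have [] := Qx' c.
  - by move=> c; rewrite !mulr_ge0.
  - by move=> c; apply: sparseZ => //; have [] := Qx' c.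
  - by move=> i; rewrite E -x_sum; apply: eq_bigr => c _; rewrite mul1r.
have : fine (varphi_k k W) <= m%:R * (K^-1 * g).
  rewrite -lee_fin -varphi_k_fin (le_trans le)// lee_fin -mulr_suml ler_wpM2r ?mulr_ge0//.
  by apply: le_trans S1 _; rewrite sumr_const card_ord.
by rewrite mulrCA -ler_pdivlMl.
Qed.

End PhiBounds.

(** * The law of the random graph *)

Section GraphLaw.
Variables (R : realType) (k : nat) (S : 'I_k -> set R).
Hypothesis S_meas : forall i, measurable (S i).
Hypothesis S_cover : \bigcup_i S i = `[0, 1]%classic.
Hypothesis S_triv : trivIset setT S.
Variables (W : R -> R -> R) (a : 'I_k -> 'I_k -> R).
Hypothesis WE : forall i j x y, S i x -> S j y -> 1 - W x y = expR (- a i j).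
Hypothesis k_gt0 : (0 < k)%N.
Variable s : 'I_k -> R.
Hypothesis sE : forall i, (s i)%:E = unif01 R (S i).

(** The default is taken only outside [[0, 1]], where the sample points never lie. *)
Definition block_of (x : R) : 'I_k :=
  if pselect (exists i, S i x) is left e then projT1 (cid e) else Ordinal k_gt0.

Lemma block_ofP x : x \in `[0, 1] -> S (block_of x) x.
Proof.
move=> /(block_exists S_cover) e; rewrite /block_of; case: pselect => // e'.
by case: cid.
Qed.

Variables (d : measure_display) (Omega : measurableType d) (P : probability Omega R)
  (n : nat) (G : Omega -> simple_graph 'I_n).
Hypothesis adj_meas : forall i j, measurable [set w | adj (G w) i j].

Definition conf_of (H : simple_graph 'I_n) : {ffun 'I_n * 'I_n -> bool} :=
  [ffun e => adj H e.1 e.2 && (e.1 < e.2)%N].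

Lemma measurable_conf (u : {ffun 'I_n * 'I_n -> bool}) :
  measurable [set w | conf_of (G w) = u].
Proof.
rewrite (_ : [set w | _] = \bigcap_(e in [set: 'I_n * 'I_n])
    [set w | adj (G w) e.1 e.2 && (e.1 < e.2)%N = u e]).
  apply: fin_bigcap_measurable; first exact: finite_finset.
  move=> e _; case: (e.1 < e.2)%N; last first.
    rewrite (_ : [set w | _] = if u e then set0 else setT).
      by case: ifP => _; [exact: measurable0|exact: measurableT].
    by apply/seteqP; split => w /=; case: (u e); rewrite andbF.
  have [ue|ue] := boolP (u e).
    rewrite (_ : [set w | _] = [set w | adj (G w) e.1 e.2]) //.
    by apply/seteqP; split => w /=; rewrite andbT.
  rewrite (_ : [set w | _] = ~` [set w | adj (G w) e.1 e.2]); first exact: measurableC.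
  by apply/seteqP; split => w /=; rewrite andbT => H; [rewrite H|exact/negbTE/negP].
apply/seteqP; split => w /=.
  by move=> <- e _ /=; rewrite ffunE.
by move=> H; apply/ffunP => e; rewrite ffunE; exact: H.
Qed.

Lemma conf_of_adj (H H' : simple_graph 'I_n) :
  adj H =2 adj H' <-> conf_of H = conf_of H'.
Proof.
split=> [HH|HH]; first by apply/ffunP => e; rewrite !ffunE HH.
have lt_case (i j : 'I_n) : (i < j)%N -> adj H i j = adj H' i j.
  by move=> ij; move/ffunP: HH => /(_ (i, j)); rewrite !ffunE /= ij !andbT.
move=> i j; case: (ltngtP i j) => [||/val_inj ->].
- exact: lt_case.
- by move=> ji; rewrite adj_sym [RHS]adj_sym lt_case.
- by rewrite !adj_irr.
Qed.

Variable X : 'I_n -> {RV P >-> R}.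
Hypothesis X_unif : indep_uniform X.
Hypothesis X_law : forall (H : simple_graph 'I_n) (A : set Omega),
  g_sigma_preimage (fun i => X i : Omega -> R) A ->
  P (A `&` [set w | adj (G w) =2 adj H]) =
  (\int[P]_(w in A)
    (\prod_(i < n) \prod_(j < n | (i < j)%N)
      (if adj H i j then W (X i w) (X j w) else 1 - W (X i w) (X j w)))%:E)%E.

Definition types_of (w : Omega) : {ffun 'I_n -> 'I_k} := [ffun j => block_of (X j w)].

Lemma types_eventE (t : {ffun 'I_n -> 'I_k}) :
  [set w | types_of w = t] = \bigcap_j (X j @^-1` S (t j)).
Proof.
have [X01 _ _] := X_unif.
apply/seteqP; split => w /=.
  by move=> <- j _ /=; rewrite ffunE; apply: block_ofP; exact: X01.
move=> H; apply/ffunP => j; rewrite ffunE.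
by apply: (block_uniq S_triv) (H j I); apply: block_ofP; exact: X01.
Qed.

Lemma types_event_sigma (t : {ffun 'I_n -> 'I_k}) :
  g_sigma_preimage (fun i => X i : Omega -> R) [set w | types_of w = t].
Proof.
rewrite types_eventE /g_sigma_preimage.
set GG := \big[setU/set0]_(_ < _) _.
have := @fin_bigcap_measurable _ (g_sigma_algebraType GG) 'I_n setT
  (fun j => X j @^-1` S (t j)) finite_finset.
apply => j _; apply: sub_sigma_algebra; rewrite /GG -bigcup_seq_cond.
exists j => /=; first by rewrite mem_index_enum.
by exists (S (t j)); [exact: S_meas|rewrite setTI].
Qed.

Lemma measurable_types (t : {ffun 'I_n -> 'I_k}) : measurable [set w | types_of w = t].
Proof.
rewrite types_eventE; apply: fin_bigcap_measurable; first exact: finite_finset.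
move=> j _; rewrite -[_ @^-1` _]setTI; apply: measurable_funP => //; exact: S_meas.
Qed.

Lemma prob_types (t : {ffun 'I_n -> 'I_k}) :
  P [set w | types_of w = t] = (type_prob s t)%:E.
Proof.
have [_ Xu Xi] := X_unif.
rewrite types_eventE Xi; last by move=> j; exact: S_meas.
rewrite /type_prob -prodEFin; apply: eq_bigr => j _.
by rewrite sE -(Xu j _ (S_meas (t j))).
Qed.


Definition graph_of_conf (u : {ffun 'I_n * 'I_n -> bool}) : rel 'I_n :=
  fun i j => ((i < j)%N && u (i, j)) || ((j < i)%N && u (j, i)).

Lemma graph_of_conf_sym u : symmetric (graph_of_conf u).
Proof. by move=> i j; rewrite /graph_of_conf orbC. Qed.

Lemma graph_of_conf_irr u : irreflexive (graph_of_conf u).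
Proof. by move=> i; rewrite /graph_of_conf ltnn. Qed.

(** The event of having types [t] belongs to the sigma-algebra of the sample points, and on it the
    integrand in [X_law] is the constant [conf_weight]. A configuration with a coordinate on outside
    [i < j] never occurs, and its weight is 0. *)
Lemma joint_law (t : {ffun 'I_n -> 'I_k}) (u : {ffun 'I_n * 'I_n -> bool}) :
  P ([set w | types_of w = t] `&` [set w | conf_of (G w) = u]) =
  (type_prob s t * conf_weight (edge_prob a t) u)%:E.
Proof.
have [/forallP upper|/forallPn[e]] := boolP [forall e, u e ==> (e.1 < e.2)%N]; last first.
  rewrite negb_imply => /andP[ue e12].
  rewrite (_ : _ `&` _ = set0) ?measure0; last first.
    apply/seteqP; split => // w [_ /= /ffunP/(_ e)].
    by rewrite ffunE ue (negbTE e12) andbF.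
  rewrite /conf_weight (bigD1 e)//= ue {1}/edge_prob (negbTE e12) mul0r mulr0//.
pose H := SimpleGraph (graph_of_conf_sym u) (graph_of_conf_irr u).
have uH : conf_of H = u.
  apply/ffunP => -[i j]; rewrite ffunE /= /graph_of_conf.
  have := upper (i, j); have := upper (j, i); rewrite /=.
  by case: (ltngtP i j) => _; case: (u (i, j)); case: (u (j, i)).
have -> : [set w | conf_of (G w) = u] = [set w | adj (G w) =2 adj H].
  by apply/seteqP; split => w /= Hw;
    [apply: (proj2 (conf_of_adj (G w) H)); rewrite uH|
     rewrite -uH; exact: (proj1 (conf_of_adj (G w) H))].
rewrite X_law; last exact: types_event_sigma.
have [X01 _ _] := X_unif.
rewrite (eq_integral (fun=> (conf_weight (edge_prob a t) u)%:E)) => [|w /set_mem /= wt_w].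
  rewrite [LHS]integral_cst; last exact: measurable_types.
  by rewrite mulrC EFinM; congr (_ * _)%E; exact: prob_types.
congr (_%:E); rewrite pair_big_dep /= big_mkcond /=.
apply: eq_bigr => -[i j] _ /=; rewrite /graph_of_conf /edge_prob /=.
have Xb l : S (t l) (X l w).
  by rewrite -wt_w ffunE; apply: block_ofP; exact: X01.
have Wij := WE (Xb i) (Xb j).
case: ltnP => ij /=.
  rewrite ltnNge (ltnW ij) /= orbF; case: (u (i, j)) => //.
    by rewrite -Wij subKr.
  by rewrite subKr.
have := upper (i, j); rewrite /= ltnNge ij implybF => /negbTE ->.
by rewrite subr0.
Qed.

(** This replaces the abstract probability space by a finite average over types and
    configurations. *)
Lemma prob_conf (Q : {ffun 'I_n -> 'I_k} -> {ffun 'I_n * 'I_n -> bool} -> bool) :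
  P [set w | Q (types_of w) (conf_of (G w))] =
  (\sum_t type_prob s t * Ex (edge_prob a t) (fun u => (Q t u)%:R))%:E.
Proof.
pose F (tu : {ffun 'I_n -> 'I_k} * {ffun 'I_n * 'I_n -> bool}) :=
  [set w | types_of w = tu.1] `&` [set w | conf_of (G w) = tu.2].
have FE : [set w | Q (types_of w) (conf_of (G w))] =
    \bigcup_(tu in [set tu | Q tu.1 tu.2]) F tu.
  apply/seteqP; split => w /=.
    by move=> Qw; exists (types_of w, conf_of (G w)).
  by move=> [[t u] /= Qtu [/= -> ->]].
rewrite FE (measure_fin_bigcup P (D := [set tu | Q tu.1 tu.2])) //; last 3 first.
- exact: finite_finset.
- by move=> [t u] [t' u'] _ _ [w [[/= <- <-] [/= -> ->]]].
- move=> [t u] _; apply: measurableI; [exact: measurable_types|exact: measurable_conf].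
rewrite -[LHS](@bigfs _ _ _ _ (index_enum _) (fun tu => Q tu.1 tu.2)); last 2 first.
- exact: index_enum_uniq.
- by move=> tu _; rewrite mem_index_enum.
rewrite (eq_bigr (fun tu => (type_prob s tu.1 * conf_weight (edge_prob a tu.1) tu.2)%:E)); last first.
  by move=> [t u] _; exact: joint_law.
rewrite sumEFin; congr EFin; rewrite big_mkcond /=.
rewrite -(pair_bigA _ (fun t u => if Q t u then type_prob s t * conf_weight (edge_prob a t) u else 0)) /=.
apply: eq_bigr => t _; rewrite /Ex mulr_sumr; apply: eq_bigr => u _.
by case: (Q t u); rewrite ?mulr1 ?mulr0.
Qed.

End GraphLaw.

(** * Asymptotics *)

Section Asymptotics.
Variable R : realType.
Implicit Types (l A B e d L C : R).

(** Here and below [l] stands for the logarithm of the number of vertices. The quadratic term of the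
    exponential series already suffices. *)
Lemma expR_dominates A d : 0 < d -> \forall l \near +oo%R, A * (1 + l) <= expR (d * l).
Proof.
move=> d0; near=> l.
have l1 : 1 <= l by near: l; apply: nbhs_pinfty_ge; exact: num_real.
have lA : 4 * `|A| / d ^+ 2 <= l by near: l; apply: nbhs_pinfty_ge; exact: num_real.
have d2 : 0 < d ^+ 2 by rewrite exprn_gt0.
have : 4 * `|A| <= l * d ^+ 2 by rewrite -ler_pdivrMr.
have dl0 : 0 <= d * l by rewrite mulr_ge0 ?(ltW d0)//; lra.
move=> H; apply: le_trans (expR_ge1Dxn 1 dl0).
have : A * (1 + l) <= `|A| * (1 + l).
  by rewrite ler_wpM2r ?ler_norm//; lra.
have : `|A| * (1 + l) <= `|A| * (2 * l) by rewrite ler_wpM2l//; lra.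
have : (4 * `|A|) * l <= (l * d ^+ 2) * l by rewrite ler_wpM2r//; lra.
rewrite (_ : 2`!%:R = 2)// exprMn.
have -> : l * d ^+ 2 * l = d ^+ 2 * l ^+ 2 by ring.
lra.
Unshelve. all: by end_near. Qed.

Lemma expRN_small A e : 0 < e -> \forall l \near +oo%R, A * expR (- l) <= e.
Proof.
move=> e0; near=> l.
have l0 : 0 <= l by near: l; apply: nbhs_pinfty_ge; exact: num_real.
rewrite expRN ler_pdivrMr ?expR_gt0// -ler_pdivrMl//.
have H : e^-1 * A * (1 + l) <= expR (1 * l) by near: l; exact: expR_dominates.
rewrite mul1r in H; have [A0|A0] := leP 0 A.
  by apply: le_trans H; rewrite ler_peMr ?mulr_ge0 ?invr_ge0 ?(ltW e0)//; lra.
by apply: le_trans (expR_ge0 l); rewrite pmulr_rle0 ?invr_gt0// ltW.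
Unshelve. all: by end_near. Qed.

(** The factor [expR (expR l)], that is [e^n], dominates the number of vertex sets. For [l >= 16]
    the last exponent is at most [1 / 2 - 2 * expR l], so one [expR l] is left over. *)
Lemma tail_small A e : 0 <= A -> 0 < e -> \forall l \near +oo%R,
  A * expR (expR l) * expR (2^-1 - expR (3 / 2 * l - 1) / 4) <= e.
Proof.
move=> A0 e0; near=> l.
have l4 : 16 <= l by near: l; apply: nbhs_pinfty_ge; exact: num_real.
have H : A * expR 2^-1 * expR (- l) <= e by near: l; exact: expRN_small.
apply: le_trans H; rewrite -[leLHS]mulrA -[leRHS]mulrA -!expRD ler_wpM2l// ler_expR.
have -> : 3 / 2 * l - 1 = l + (2^-1 * l - 1) by lra.
rewrite expRD; have y1 := expR_ge1Dx l.
have : expR l * 8 <= expR l * expR (2^-1 * l - 1).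
  rewrite ler_wpM2l ?expR_ge0//; have := expR_ge1Dx (2^-1 * l - 1); lra.
lra.
Unshelve. all: by end_near. Qed.

Lemma first_moment_small d e : 0 < d -> 0 < e ->
  \forall l \near +oo%R, expR (expR (- (d * l))) - 1 <= e.
Proof.
move=> d0 e0; near=> l.
have l0 : 0 <= l by near: l; apply: nbhs_pinfty_ge; exact: num_real.
have H : 2 * (1 + e^-1) * (1 + l) <= expR (d * l) by near: l; exact: expR_dominates.
have ie : 0 < e^-1 by rewrite invr_gt0.
have le1 : 2 * (1 + e^-1) <= expR (d * l).
  by apply: le_trans H; rewrite ler_peMr; lra.
set z := expR (- (d * l)).
have zE : z * expR (d * l) = 1 by rewrite /z expRN mulVf// gt_eqF ?expR_gt0.
have z0 : 0 < z by exact: expR_gt0.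
have zb : z * (2 * (1 + e^-1)) <= 1 by rewrite -[leRHS]zE ler_wpM2l// ltW.
have zie : 0 <= z * e^-1 by rewrite mulr_ge0 ?(ltW z0) ?(ltW ie).
have z2 : z <= 2^-1 by lra.
have ze : 2 * z <= e.
  have : 2 * (z * e^-1) * e <= 1 * e by rewrite ler_wpM2r ?(ltW e0)//; lra.
  by rewrite -!mulrA mulVf ?gt_eqF// mulr1 mul1r.
have zp : 0 < 1 - z by lra.
have : expR z * (1 - z) <= 1.
  rewrite -[leRHS](expRxMexpNx_1 z) ler_wpM2l ?expR_ge0//.
  exact: expR_ge1Dx.
have : expR z * (1 - z) <= 1 -> expR z - 1 <= 2 * z.
  rewrite -ler_pdivlMr// => H1; rewrite lerBlDr; apply: le_trans H1 _.
  rewrite ler_pdivrMr//; nra.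
lra.
Unshelve. all: by end_near. Qed.

(** Take [b] about [n^(1 - d/4)] and [c] about [C * l], so that each shared vertex gains at least
    [(1 - d/2) * l]. If [m >= 3 / d], sparsity loses only [(1 - d) * l] per vertex, and the net gain
    [m * d * l / 2] is at least [3 / 2 * l]. If [2 <= m < 3 / d], the energy is at most
    [9 * L / d^2 <= l / 4], while the gain is at least [(2 - d) * l >= 7 / 4 * l]. *)
Lemma cell_sizes L d C A e : 0 <= L -> 0 < d <= 4^-1 -> 0 <= C -> 0 <= A -> 0 < e ->
  \forall l \near +oo%R, exists b c : nat,
    [/\ (0 < b)%N, (0 < c)%N, C * l <= c%:R, A * (b * c)%:R * l <= e * expR l &
     forall m, (1 < m)%N ->
       Num.min ((1 - d) * l * m%:R) (L * m%:R ^+ 2) + m%:R * (ln c%:R - ln b%:R)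
       <= - (3 / 2 * l)].
Proof.
move=> L0 /andP[d0 d4] C0 A0 e0; pose h := d / 4.
have h0 : 0 < h by rewrite divr_gt0.
near=> l.
have l1 : 1 <= l by near: l; apply: nbhs_pinfty_ge; exact: num_real.
have Cl : (C + 1) * (1 + l) <= expR (h / 2 * l).
  by near: l; apply: expR_dominates; rewrite divr_gt0.
have Ll : 36 * L / d ^+ 2 <= l by near: l; apply: nbhs_pinfty_ge; exact: num_real.
have Al : (e^-1 * 2 * A) * (1 + l) <= expR (h / 2 * l).
  by near: l; apply: expR_dominates; rewrite divr_gt0.
have l0 : 0 <= l by lra.
exists (Num.truncn (expR ((1 - h) * l))).+1, (Num.truncn (C * l)).+1.
set b := (Num.truncn _).+1; set c := (Num.truncn (C * l)).+1.
have b1 : expR ((1 - h) * l) <= b%:R by apply/ltW; exact: truncnS_gt.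
have b2 : b%:R <= 2 * expR ((1 - h) * l).
  rewrite /b -natr1; have : (Num.truncn (expR ((1 - h) * l)))%:R <= expR ((1 - h) * l).
    by rewrite truncn_le expR_ge0.
  have : 1 <= expR ((1 - h) * l) by rewrite -[leLHS]expR0 ler_expR mulr_ge0//; rewrite /h; lra.
  lra.
have c1 : C * l <= c%:R by apply/ltW; exact: truncnS_gt.
have c2 : c%:R <= expR (h / 2 * l).
  apply: le_trans Cl; rewrite /c -natr1.
  have : (Num.truncn (C * l))%:R <= C * l by rewrite truncn_le mulr_ge0.
  have : 0 <= C * 1 by rewrite mulr1.
  lra.
split => //.
  rewrite natrM; have : b%:R * c%:R <= 2 * expR ((1 - h) * l) * expR (h / 2 * l).
    by rewrite ler_pM.
  move=> bc; apply: (@le_trans _ _ (A * (2 * expR ((1 - h) * l) * expR (h / 2 * l)) * l)).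
    by rewrite ler_wpM2r// ler_wpM2l.
  have -> : expR l = expR (h / 2 * l) * (expR ((1 - h) * l) * expR (h / 2 * l)).
    by rewrite -!expRD; congr expR; lra.
  set y := expR ((1 - h) * l) * expR (h / 2 * l); have y0 : 0 <= y by rewrite mulr_ge0 ?expR_ge0.
  rewrite -(mulrA 2) -/y.
  have : e * (e^-1 * 2 * A * (1 + l)) * y <= e * expR (h / 2 * l) * y.
    by rewrite ler_wpM2r// ler_wpM2l// ltW.
  have -> : e * (e^-1 * 2 * A * (1 + l)) * y = 2 * A * y * (1 + l).
    by field; rewrite gt_eqF.
  have : 0 <= A * y by rewrite mulr_ge0.
  lra.
move=> m m1.
have cp : (0 : R) < c%:R by rewrite ltr0n.
have bp : (0 : R) < b%:R by rewrite ltr0n.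
have lnc : ln c%:R <= h / 2 * l by rewrite -[leRHS]expRK ler_ln ?posrE ?expR_gt0.
have lnb : (1 - h) * l <= ln b%:R by rewrite -[leLHS]expRK ler_ln ?posrE ?expR_gt0.
have m2 : 2 <= m%:R :> R by rewrite ler_nat.
have m0 : 0 <= m%:R :> R by rewrite ler0n.
have : m%:R * (ln c%:R - ln b%:R) <= m%:R * (- ((1 - 2 * h) * l)).
  rewrite ler_wpM2l//; have : 0 <= h * l by rewrite mulr_ge0// ltW.
  lra.
rewrite /h; have [md|md] := leP (3 / d) m%:R.
  have dm : 3 <= m%:R * d by rewrite -ler_pdivrMr.
  have : Num.min ((1 - d) * l * m%:R) (L * m%:R ^+ 2) <= ((1 - d) * l * m%:R) by rewrite ge_min lexx.
  have : 3 * l <= m%:R * d * l by rewrite ler_wpM2r.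
  lra.
have : Num.min ((1 - d) * l * m%:R) (L * m%:R ^+ 2) <= (L * m%:R ^+ 2) by rewrite ge_min lexx orbT.
have : L * m%:R ^+ 2 <= L * (3 / d) ^+ 2.
  by rewrite ler_wpM2l// lerXn2r ?nnegrE// ?(ltW md) ?divr_ge0// ltW.
have : L * (3 / d) ^+ 2 <= l / 4.
  have -> : L * (3 / d) ^+ 2 = (36 * L / d ^+ 2) / 4 by field; rewrite gt_eqF.
  lra.
have : 2 * ((1 - 2 * (d / 4)) * l) <= m%:R * ((1 - 2 * (d / 4)) * l).
  by rewrite ler_wpM2r// mulr_ge0//; lra.
have : d * l <= 4^-1 * l by rewrite ler_wpM2r.
lra.
Unshelve. all: by end_near. Qed.

(** Before rounding the product is [(1 + d) ^+ 2 * N * x]. One factor [1 + d] pays for truncating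
    the profile, as [z - 1 >= z / (1 + d)] once [z >= (1 + d) / d]; the other remains as a margin
    for the fluctuation of the type counts. *)
Lemma rounding (d g x N l : R) : 0 < d <= 4^-1 -> 0 < g -> 0 <= x -> 0 <= N -> 0 < l ->
  (x != 0 -> (1 + d) / d <= 2 * (1 - d) * x * l / g) ->
  (1 + d) * N * x <=
    (((Num.truncn ((1 + d) ^+ 2 * N * g / (2 * (1 - d) * l))).+1 *
      Num.truncn (2 * (1 - d) * x * l / g))%N)%:R.
Proof.
move=> /andP[d0 d4] g0 x0 N0 l0 H; rewrite natrM.
have [->|xN0] := eqVneq x 0; first by rewrite mulr0 mulr_ge0.
have {}H := H xN0; set z := _ * x * l / g in H *; set y := _ / (2 * (1 - d) * l).
have d1 : 0 < 1 + d by lra.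
have d1' : 0 < 1 - d by lra.
have qz : z / (1 + d) <= (Num.truncn z)%:R.
  have : z < (Num.truncn z).+1%:R by exact: truncnS_gt.
  rewrite -natr1 => zq; apply: (@le_trans _ _ (z - 1)); last lra.
  rewrite ler_pdivrMr//; have := H; rewrite ler_pdivrMr//; lra.
have yJ : y <= (Num.truncn y).+1%:R by apply/ltW; exact: truncnS_gt.
have -> : (1 + d) * N * x = y * (z / (1 + d)).
  by rewrite /y /z; field; rewrite !gt_eqF.
have l0' := ltW l0; have g0' := ltW g0; have d1'' := ltW d1'; have d1a := ltW d1.
have z0 : 0 <= z by rewrite /z divr_ge0// !mulr_ge0.
have y0 : 0 <= y by rewrite /y divr_ge0// !mulr_ge0.
by rewrite ler_pM// divr_ge0// ltW.
Qed.

End Asymptotics.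

Lemma block_graphon_data (R : realType) (k : nat) (W : R -> R -> R) :
  block_graphon k W -> {in `[0, 1] &, forall x y, W x y < 1} ->
  exists (S : 'I_k -> set R) (a : 'I_k -> 'I_k -> R) (L : R),
    [/\ (forall i, measurable (S i)) /\ \bigcup_i S i = `[0, 1]%classic,
        trivIset setT S,
        (forall i j, 0 <= a i j) /\ (forall i j, a i j = a j i),
        forall i j x y, S i x -> S j y -> 1 - W x y = expR (- a i j) &
        [/\ forall i j, a i j <= L, 0 <= L & (0 < k)%N]].
Proof.
move=> [[_ W_sym W01] [p [S [_ S_meas S_cover S_triv WE]]]] W_lt1.
have S01 i x : S i x -> x \in `[0, 1].
  move=> Six; have : (`[0, 1]%classic : set R) x by rewrite -S_cover; exists i.
  by [].
have k_gt0 : (0 < k)%N.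
  have : (`[0, 1]%classic : set R) 0 by rewrite /= in_itv /= lexx ler01.
  by rewrite -S_cover => -[i _ _]; exact: leq_ltn_trans (ltn_ord i).
have Wp i j x y : S i x -> S j y -> W x y = p i j.
  move=> Six Sjy; rewrite WE ?(S01 i x) ?(S01 j y)//.
  have ind l z m : S l z -> \1_(S m) z = (m == l)%:R :> R.
    move=> Slz; rewrite indicE; case: eqVneq => [->|ml]; first by rewrite mem_set.
    rewrite memNset// => Smz; move/eqP: ml; apply.
    by apply: (S_triv m l) => //; exists z.
  rewrite (bigD1 i)//= (bigD1 j)//= (ind _ _ _ Six) (ind _ _ _ Sjy) !eqxx !mulr1.
  rewrite big1 => [|j' /negbTE j'j]; last by rewrite (ind _ _ _ Sjy) j'j mulr0.
  rewrite big1 => [|i' /negbTE i'i]; first by rewrite !addr0.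
  by rewrite big1// => j' _; rewrite (ind _ _ _ Six) i'i mulr0 mul0r.
(* The matrix [a] is read off [W] at representatives, not off [p]: on pairs with an empty block [p]
   may be asymmetric or equal to 1. Empty blocks get the dummy representative 0. *)
pose r i : R := if pselect (exists x, S i x) is left e then projT1 (cid e) else 0.
have r01 i : r i \in `[0, 1].
  rewrite /r; case: pselect => [e|_]; first by case: cid => x /= /S01.
  by rewrite in_itv /= lexx ler01.
have rS i x : S i x -> S i (r i).
  by move=> Six; rewrite /r; case: pselect => [e|[]]; [case: cid|exists x].
pose a i j := - ln (1 - W (r i) (r j)).
have a_ge0 i j : 0 <= a i j.
  rewrite oppr_ge0; apply: ln_le0; have /andP[] := W01 _ _ (r01 i) (r01 j); lra.
exists S, a, (\sum_i \sum_j a i j); split => //.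
- by split=> // i j; rewrite /a W_sym// r01.
- move=> i j x y Six Sjy; rewrite (Wp _ _ _ _ Six Sjy).
  rewrite -(Wp _ _ _ _ (rS _ _ Six) (rS _ _ Sjy)) /a opprK lnK// posrE subr_gt0.
  exact: W_lt1.
- split => //; last by apply: sumr_ge0 => i _; apply: sumr_ge0.
  move=> i j; rewrite (bigD1 i)//= (bigD1 j)//= -addrA lerDl addr_ge0 ?sumr_ge0//.
  by move=> i' _; apply: sumr_ge0.
Qed.

(** * The random graph with given, nearly balanced types *)

Section FixedTypes.
Variables (R : realType) (k n : nat) (a : 'I_k -> 'I_k -> R) (t : 'I_n -> 'I_k).
Hypothesis n_gt0 : (0 < n)%N.
Hypothesis a_ge0 : forall i j, 0 <= a i j.
Hypothesis a_sym : forall i j, a i j = a j i.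
Variables (L : R) (aL : forall i j, a i j <= L) (L_ge0 : 0 <= L).
Variables (s : 'I_k -> R) (F : R).
Hypothesis F_lower : forall m (v : 'I_m -> 'I_k -> R) (g K : R),
  (forall c i, 0 <= v c i) -> 0 <= g -> (forall c, sparse a g (v c)) -> 0 <= K ->
  (forall i, K * s i <= \sum_c v c i) -> K * F <= m%:R * g.
Variables (m0 : nat) (x : 'I_m0 -> 'I_k -> R) (g : 'I_m0 -> R).
Hypothesis x_ge0 : forall c i, 0 <= x c i.
Hypothesis g_gt0 : forall c, 0 < g c.
Hypothesis x_sparse : forall c, sparse a (g c) (x c).
Hypothesis x_sum : forall i, \sum_c x c i = s i.
Variables (d l : R).
Hypothesis d_bound : 0 < d <= 4^-1.
Hypothesis l_gt0 : 0 < l.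
Hypothesis nE : n%:R = expR l.
Variables (b c : nat).
Hypothesis b_gt0 : (0 < b)%N.
Hypothesis c_gt0 : (0 < c)%N.
Let q (h : 'I_m0) (i : 'I_k) : nat := Num.truncn (2 * (1 - d) * x h i * l / g h).
Let J (h : 'I_m0) : nat := (Num.truncn ((1 + d) ^+ 2 * n%:R * g h / (2 * (1 - d) * l))).+1.
Hypothesis q_sum : forall h, (\sum_i q h i <= c)%N.
Hypothesis x_large : forall h i, x h i != 0 ->
  (1 + d) / d <= 2 * (1 - d) * x h i * l / g h.
Hypothesis numeric : forall m, (1 < m)%N ->
  Num.min ((1 - d) * l * m%:R) (L * m%:R ^+ 2) + m%:R * (ln c%:R - ln b%:R)
  <= - (3 / 2 * l).
Hypothesis balanced : forall i,
  `|(type_count t [set: 'I_n]%SET i)%:R - n%:R * s i| <= d * (n%:R * s i).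
Implicit Types w : {ffun 'I_n * 'I_n -> bool}.

Let pr := edge_prob a t.
Let pr01 e : 0 <= pr e <= 1.
Proof. by have /andP[-> /ltW] := edge_prob01 t a_ge0 e. Qed.

Let d_gt0 : 0 < d. Proof. by have /andP[] := d_bound. Qed.
Let d_le : d <= 4^-1. Proof. by have /andP[] := d_bound. Qed.

Definition violating w := [exists U : {set 'I_n}, [&& U != finset.set0,
  expR (- energy a t U) <= expR (- ((1 + d) * l)) ^+ #|U| & absent (edges U) w]].

Definition all_profiles w := [forall h, [forall U : {set 'I_n},
  has_profile t (restricted t (b * c) (q h) U) U w]].

(** This is [first_moment] with [r = n^(-(1 + d))], for which [(1 + r) ^ n <= expR (n * r) = expR
    (n^(-d))]. *)
Lemma violating_prob :
  Ex pr (fun w => (violating w)%:R) <= expR (expR (- (d * l))) - 1.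
Proof.
apply: le_trans (first_moment t a_ge0 (expR_ge0 _)) _; rewrite lerD2r.
have -> : expR (expR (- (d * l))) = expR (expR (- ((1 + d) * l))) ^+ n.
  rewrite -expRM_natl nE -expRD; congr (expR (expR _)); lra.
by rewrite lerXn2r ?nnegrE ?expR_ge0 ?addr_ge0 ?expR_ge0// expR_ge1Dx.
Qed.

(** The profile lies below [z * x h] with [z = 2 * (1 - d) * l / g h], a vector of cost
    [z * g h = 2 * (1 - d) * l]; [sparse_box] passes this on to every subprofile. *)
Lemma profile_tail_types (h : 'I_m0) (U : {set 'I_n}) :
  Ex pr (fun w => (~~ has_profile t (restricted t (b * c) (q h) U) U w)%:R)
  <= expR (2^-1 - expR (3 / 2 * l - 1) / 4).
Proof.
have rq i : (restricted t (b * c) (q h) U i <= q h i)%N.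
  by rewrite /restricted; case: ifP.
have qc i : (q h i <= c)%N by apply: leq_trans (q_sum h); rewrite (bigD1 i)//= leq_addr.
have g0 := g_gt0 h; have l0 := ltW l_gt0.
have d1 : 0 <= 1 - d by move: d_le; lra.
apply: (profile_tail n_gt0 a_ge0 a_sym aL b_gt0 c_gt0) numeric.
- by apply: leq_trans (q_sum h); exact: leq_sum.
- move=> i; rewrite /restricted; case: ifP => // bU.
  by apply: leq_trans bU; rewrite mulnC leq_mul2l qc orbT.
- move=> y yq; pose z := 2 * (1 - d) * l / g h.
  have z0 : 0 <= z by rewrite /z divr_ge0 ?(ltW g0)// !mulr_ge0.
  have := @sparse_box _ _ a a_ge0 (z * g h) (fun i => z * x h i) (fun i => (y i)%:R)
    (sparseZ z0 (x_sparse h)).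
  rewrite {1}/z divfK ?gt_eqF// => H.
  have -> : \sum_i \sum_j a i j * (y i)%:R * (y j)%:R = quad a (fun i => (y i)%:R) [set: 'I_k]%SET.
    rewrite /quad; apply: eq_big => [i|i _]; first by rewrite inE.
    by apply: eq_bigl => j; rewrite inE.
  rewrite (mulrA 2); apply: H => i; rewrite ler0n /=.
  apply: (@le_trans _ _ (q h i)%:R); first by rewrite ler_nat (leq_trans (yq i)).
  rewrite /q; have -> : z * x h i = 2 * (1 - d) * x h i * l / g h by rewrite /z; ring.
  by rewrite truncn_le divr_ge0 ?(ltW g0)// !mulr_ge0.
Qed.

Lemma profiles_prob : Ex pr (fun w => (~~ all_profiles w)%:R) <=
  m0%:R * expR (expR l) * expR (2^-1 - expR (3 / 2 * l - 1) / 4).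
Proof.
apply: (@le_trans _ _ (Ex pr (fun w => \sum_h \sum_(U : {set 'I_n})
  (~~ has_profile t (restricted t (b * c) (q h) U) U w)%:R))).
  apply: ler_Ex => // w; have [_|] := boolP (all_profiles w).
    by rewrite sumr_ge0// => h _; rewrite sumr_ge0.
  rewrite negb_forall => /existsP[h]; rewrite negb_forall => /existsP[U hU].
  rewrite (bigD1 h)//= (bigD1 U)//= hU -addrA lerDl addr_ge0 ?sumr_ge0// => h' _.
  by rewrite sumr_ge0.
rewrite Ex_sum; under eq_bigr do rewrite Ex_sum.
apply: (@le_trans _ _ (\sum_(h < m0) \sum_(U : {set 'I_n})
    expR (2^-1 - expR (3 / 2 * l - 1) / 4))).
  by apply: ler_sum => h _; apply: ler_sum => U _; exact: profile_tail_types.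
rewrite !sumr_const card_ord -[leLHS]mulr_natl -[leRHS]mulrA ler_wpM2l//.
rewrite -[leLHS]mulr_natl ler_wpM2r ?expR_ge0//.
have -> : #|{set 'I_n}| = (2 ^ n)%N by rewrite -cardsT -powersetT card_powerset cardsT card_ord.
(* The [2 ^ n] vertex sets are counted by [e ^ n], which has the form that [tail_small] expects. *)
rewrite natrX -nE -[X in expR X]mulr1 expRM_natl lerXn2r ?nnegrE ?expR_ge0//.
by have := expR_ge1Dx (1 : R); lra.
Qed.

Lemma not_violating_colours w m : ~~ violating w -> conf_colorable w m ->
  (1 - d) * n%:R * F <= m%:R * (2 * ((1 + d) * l) + L).
Proof.
move=> nv; have l0 := ltW l_gt0; apply: (colours_ge a_sym aL F_lower).
- by rewrite addr_ge0// !mulr_ge0// addr_ge0// ltW.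
- by rewrite mulr_ge0//; move: d_le; lra.
- move=> U U0 aU; rewrite leNgt; apply: contra nv => EU.
  apply/existsP; exists U; rewrite U0 aU andbT /= -expRM_natl ler_expR.
  by move: EU; lra.
- move=> i; have := balanced i; rewrite ler_norml => /andP[+ _]; lra.
Qed.

Lemma all_profiles_colours w : all_profiles w ->
  conf_colorable w (\sum_h J h + k * (b * c)).
Proof.
move=> /forallP ap; apply: (colours_le (t := t) (q := q)).
- by rewrite muln_gt0 b_gt0.
- by move=> h U; exact: (forallP (ap h) U).
- move=> i; rewrite -(ler_nat R) natr_sum.
  apply: (@le_trans _ _ ((1 + d) * n%:R * s i)).
    by have := balanced i; rewrite ler_norml => /andP[_]; lra.
  rewrite -x_sum mulr_sumr ler_sum// => h _.
  by apply: rounding => //; exact: x_large.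
Qed.

End FixedTypes.

(** [prob_conf] handles events determined by types and configuration, so the chromatic number is
    expressed through a graph rebuilt from the configuration. *)
Definition conf_graph (n : nat) (u : {ffun 'I_n * 'I_n -> bool}) : simple_graph 'I_n :=
  SimpleGraph (graph_of_conf_sym u) (graph_of_conf_irr u).

Lemma conf_of_conf_graph (n : nat) (H : simple_graph 'I_n) :
  conf_of (conf_graph (conf_of H)) = conf_of H.
Proof.
apply/ffunP => -[i j]; rewrite !ffunE /= /graph_of_conf !ffunE /=.
by case: ltngtP; rewrite ?andbT ?andbF ?orbF.
Qed.

Lemma chromatic_number_conf (n : nat) (H : simple_graph 'I_n) :
  chromatic_number H = chromatic_number (conf_graph (conf_of H)).
Proof.
apply/eqP; rewrite eqn_leq; apply/andP; split; apply: chromatic_number_le;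
  rewrite -/(conf_of _).
  have := chromatic_number_colorable (conf_graph (conf_of H)).
  by rewrite -/(conf_of _) conf_of_conf_graph.
by rewrite conf_of_conf_graph; exact: chromatic_number_colorable.
Qed.

Lemma conf_colorable_graph (n : nat) (u : {ffun 'I_n * 'I_n -> bool}) m :
  conf_colorable (conf_of (conf_graph u)) m <-> conf_colorable u m.
Proof.
have E (x y : 'I_n) : (x < y)%N -> conf_of (conf_graph u) (x, y) = u (x, y).
  by move=> xy; rewrite ffunE /= /graph_of_conf xy ltnNge (ltnW xy) orbF andbT.
by split=> -[c cP cm]; exists c => // x y xs ys xy uxy; apply: cP => //;
  move: uxy; rewrite E.
Qed.

Section Numeric.
Variable R : realType.

(** [L] is absorbed into [2 * d * l], so the normalised count [Z] satisfies
    [(1 - d) * F <= Z * (1 + 2 * d)]; the loss of about [3 * d * F] fits into [eps]. *)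
Lemma lower_numeric (F eps d l N L m : R) : 0 <= F -> 0 < eps -> 0 < d ->
  3 * d * F <= eps -> 0 < l -> L <= 2 * d * l -> 0 < N -> 0 <= m ->
  (1 - d) * N * F <= m * (2 * ((1 + d) * l) + L) -> F - eps <= m * (2 * l / N).
Proof.
move=> F0 e0 d0 dF l0 Ll N0 m0 H; set Z := m * (2 * l / N).
have ZN : Z * N = m * (2 * l) by rewrite /Z; field; rewrite gt_eqF.
have : m * (2 * ((1 + d) * l) + L) <= m * (2 * l) * (1 + 2 * d).
  rewrite -mulrA ler_wpM2l//; lra.
rewrite -ZN => H2.
have H3 : (1 - d) * F <= Z * (1 + 2 * d).
  rewrite -(ler_pM2r N0); lra.
rewrite leNgt; apply/negP => ZF.
have : Z * (1 + 2 * d) < (F - eps) * (1 + 2 * d) by rewrite ltr_pM2r//; lra.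
have : 0 < d * eps by rewrite mulr_gt0.
lra.
Qed.

(** The error is split into four quarters of [eps]: near optimality of [g], the factor
    [(1 + d) ^+ 2 / (1 - d) <= 1 + 5 * d], the rounding up of the [m0] repetition counts, and the
    [Kc] colours of the leftover vertices. *)
Lemma upper_numeric (F eps d l N m Kc : R) (m0 : nat) (g : 'I_m0 -> R) :
  0 <= F -> 0 < eps -> 0 < d <= 4^-1 -> 5 * d * (F + eps) <= eps / 4 ->
  0 < l -> 0 < N -> (forall h, 0 < g h) ->
  \sum_h g h <= F + eps / 4 -> m0%:R * (2 * l) <= eps / 4 * N -> 2 * Kc * l <= eps / 4 * N ->
  m <= \sum_h ((1 + d) ^+ 2 * N * g h / (2 * (1 - d) * l) + 1) + Kc ->
  m * (2 * l / N) <= F + eps.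
Proof.
move=> F0 e0 /andP[d0 d4] dF l0 N0 g0 gF m0l Kl mle.
have d1 : 0 < 1 - d by lra.
have lN : 0 < 2 * l / N by rewrite divr_gt0// mulr_gt0.
set G := \sum_h g h in gF.
have G0 : 0 <= G by apply: sumr_ge0 => h _; exact: ltW.
apply: (@le_trans _ _ ((1 + d) ^+ 2 / (1 - d) * G + m0%:R * (2 * l) / N + 2 * Kc * l / N)).
  have -> : (1 + d) ^+ 2 / (1 - d) * G + m0%:R * (2 * l) / N + 2 * Kc * l / N
      = (\sum_h ((1 + d) ^+ 2 * N * g h / (2 * (1 - d) * l) + 1) + Kc) * (2 * l / N).
    rewrite big_split /= sumr_const card_ord.
    rewrite (eq_bigr (fun h => (1 + d) ^+ 2 * N / (2 * (1 - d) * l) * g h)) => [|h _].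
      by rewrite -mulr_sumr -/G; field; rewrite !gt_eqF.
    by rewrite mulrAC.
  by rewrite ler_wpM2r// ltW.
have h1 : m0%:R * (2 * l) / N <= eps / 4 by rewrite ler_pdivrMr.
have h2 : 2 * Kc * l / N <= eps / 4 by rewrite ler_pdivrMr.
have h3 : (1 + d) ^+ 2 / (1 - d) <= 1 + 5 * d.
  rewrite ler_pdivrMr//; have : d * d <= 4^-1 * d by rewrite ler_wpM2r// ltW.
  rewrite expr2; lra.
have h4 : (1 + d) ^+ 2 / (1 - d) * G <= (1 + 5 * d) * (F + eps / 4).
  apply: (@le_trans _ _ ((1 + 5 * d) * G)); first by rewrite ler_wpM2r.
  rewrite ler_wpM2l//; lra.
have h5 : 0 < d * eps by rewrite mulr_gt0.
lra.
Qed.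

Lemma ln_nat_cvg : ln (n%:R : R) @[n --> \oo] --> +oo.
Proof.
apply/cvgryPge => A; near=> n.
have nA : ((Num.truncn (expR A)).+1 <= n)%N by near: n; exact: nbhs_infty_ge.
have An : expR A <= n%:R.
  by apply: le_trans (_ : (Num.truncn (expR A)).+1%:R <= _); rewrite ?ler_nat// ltW// truncnS_gt.
by rewrite -[leLHS]expRK ler_ln ?posrE ?expR_gt0// (lt_le_trans _ An)// expR_gt0.
Unshelve. all: by end_near. Qed.

End Numeric.

Definition within_eps (R : realType) (F eps : R) (n : nat)
    (u : {ffun 'I_n * 'I_n -> bool}) : bool :=
  `|(chromatic_number (conf_graph u))%:R * (2 * ln n%:R / n%:R) - F| <= eps.

Lemma sparse_cost_le (R : realFieldType) (k : nat) (a : 'I_k -> 'I_k -> R) (c c' : R) x :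
  c <= c' -> (forall i, 0 <= x i) -> sparse a c x -> sparse a c' x.
Proof.
by move=> cc x0 sx J; apply: le_trans (sx J) _; rewrite ler_wpM2r// sumr_ge0.
Qed.

Lemma occupancy_type_count (R : realFieldType) (k n : nat) (t : {ffun 'I_n -> 'I_k}) i :
  occupancy R t i = (type_count t [set: 'I_n]%SET i)%:R.
Proof.
rewrite /occupancy /type_count -sum1_card natr_sum [RHS]big_mkcond; apply: eq_bigr => j _.
by rewrite !inE; case: eqP.
Qed.

(** * Concentration of the chromatic number given balanced types *)

Section Concentration.
Variables (R : realType) (k : nat) (a : 'I_k -> 'I_k -> R).
Implicit Types l : R.
Hypothesis a_ge0 : forall i j, 0 <= a i j.
Hypothesis a_sym : forall i j, a i j = a j i.
Variables (L : R) (aL : forall i j, a i j <= L) (L_ge0 : 0 <= L).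
Variables (s : 'I_k -> R) (F : R).
Hypothesis F_lower : forall m (v : 'I_m -> 'I_k -> R) (g K : R),
  (forall c i, 0 <= v c i) -> 0 <= g -> (forall c, sparse a g (v c)) -> 0 <= K ->
  (forall i, K * s i <= \sum_c v c i) -> K * F <= m%:R * g.
Hypothesis F_upper : forall e, 0 < e ->
  exists m (x : 'I_m -> 'I_k -> R) (g : 'I_m -> R),
  [/\ forall c i, 0 <= x c i, forall c, 0 <= g c, forall c, sparse a (g c) (x c),
      forall i, \sum_c x c i = s i & \sum_c g c <= F + e].

Lemma value_ge0 : 0 <= F.
Proof.
apply/ler_addgt0Pr => e /F_upper[m [x [g [_ g0 _ _]]]]; apply: le_trans.
exact: sumr_ge0.
Qed.

(** The profile sizes [2 * (1 - d) * x * l / g] divide by the costs, so each cost is raised slightly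
    to be positive. *)
Lemma positive_cost_decomposition e : 0 < e ->
  exists m (x : 'I_m -> 'I_k -> R) (g : 'I_m -> R),
  [/\ forall c i, 0 <= x c i, forall c, 0 < g c, forall c, sparse a (g c) (x c),
      forall i, \sum_c x c i = s i & \sum_c g c <= F + e].
Proof.
move=> e0; have e2 : 0 < e / 2 by rewrite divr_gt0.
have [m [x [g [x0 g0 sx xs gF]]]] := F_upper e2.
pose h := e / 2 / m.+1%:R; have h0 : 0 < h by rewrite divr_gt0// ltr0n.
exists m, x, (fun c => g c + h); split => //.
- by move=> c; rewrite ltr_wpDl.
- by move=> c; apply: sparse_cost_le (sx c) => //; rewrite lerDl ltW.
rewrite big_split /= sumr_const card_ord -mulr_natr.
have : h * m%:R <= e / 2.
  rewrite /h -mulrA ler_piMr ?(ltW e2)// mulrC ler_pdivrMr ?ltr0n// mul1r.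
  by rewrite ler_nat.
lra.
Qed.

(** The vertex number is tied to a real [l] so that all limits can be taken along the real line. *)
Definition concentrated (eps e d l : R) : Prop :=
  forall (n : nat) (t : 'I_n -> 'I_k), (0 < n)%N -> n%:R = expR l ->
  (forall i, `|(type_count t [set: 'I_n]%SET i)%:R - n%:R * s i| <= d * (n%:R * s i)) ->
  1 - e <= Ex (edge_prob a t) (fun u => (within_eps F eps u)%:R).

Lemma fixed_types_concentration (eps e : R) : 0 < eps -> 0 < e ->
  exists2 d : R, 0 < d & \forall l \near +oo%R, concentrated eps e d l.
Proof.
move=> eps0 e0; have F0 := value_ge0.
have eps4 : 0 < eps / 4 by rewrite divr_gt0.
have [m0 [x [g [x0 g0 sx xs gF]]]] := positive_cost_decomposition eps4.
(* The factor 20 gives [5 * d * (F + eps) <= eps / 4], as required by [upper_numeric];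
   [3 * d * F <= eps] follows. *)
pose d := Num.min 4^-1 (eps / (20 * (F + eps))).
have Fe : 0 < 20 * (F + eps) by rewrite mulr_gt0// ltr_wpDl.
have d0 : 0 < d by rewrite lt_min invr_gt0 ltr0n divr_gt0.
have d4 : d <= 4^-1 by rewrite ge_min lexx.
have dFe : d * (20 * (F + eps)) <= eps by rewrite -ler_pdivlMr// ge_min lexx orbT.
have de0 : 0 <= d * eps by rewrite mulr_ge0 ?(ltW d0) ?(ltW eps0).
have dF0 : 0 <= d * F by rewrite mulr_ge0 ?(ltW d0).
have dF1 : 3 * d * F <= eps by lra.
have dF2 : 5 * d * (F + eps) <= eps / 4 by lra.
have d41 : 0 < d <= 4^-1 by rewrite d0.
exists d => //.
(* [C * l] bounds the size of every profile, and [l >= B] below makes every nonzero profile entry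
   large enough for [rounding]. *)
pose C := \sum_h \sum_i 2 * x h i / g h.
have C0 : 0 <= C.
  by apply: sumr_ge0 => h _; apply: sumr_ge0 => i _; rewrite divr_ge0 ?(ltW (g0 h))// mulr_ge0.
pose B := \sum_h \sum_i (1 + d) / d * g h / (2 * (1 - d) * x h i).
have B0 h i : 0 <= (1 + d) / d * g h / (2 * (1 - d) * x h i).
  have d1 : 0 <= 1 - d by lra.
  have d1' : 0 <= 1 + d by lra.
  have g0' := ltW (g0 h); have d0' := ltW d0.
  by rewrite !(divr_ge0, mulr_ge0).
have k20 : 0 <= 2 * k%:R :> R by rewrite mulr_ge0.
have e2 : 0 < e / 2 by rewrite divr_gt0.
near=> l => n t n_gt0 nE bal.
have lnE : ln n%:R = l by rewrite nE expRK.
have l1 : 1 <= l by near: l; apply: nbhs_pinfty_ge; exact: num_real.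
have lB : B <= l by near: l; apply: nbhs_pinfty_ge; exact: num_real.
have lL : L / (2 * d) <= l by near: l; apply: nbhs_pinfty_ge; exact: num_real.
have [b [c [b0 c0 Cl bcl num]]] : exists b c : nat,
    [/\ (0 < b)%N, (0 < c)%N, C * l <= c%:R, 2 * k%:R * (b * c)%:R * l <= eps / 4 * expR l &
     forall m, (1 < m)%N ->
       Num.min ((1 - d) * l * m%:R) (L * m%:R ^+ 2) + m%:R * (ln c%:R - ln b%:R)
       <= - (3 / 2 * l)].
  by near: l; exact: cell_sizes.
have tail : m0%:R * expR (expR l) * expR (2^-1 - expR (3 / 2 * l - 1) / 4) <= e / 2.
  by near: l; exact: tail_small.
have viol : expR (expR (- (d * l))) - 1 <= e / 2 by near: l; exact: first_moment_small.
have m0l : 8 * m0%:R / eps * (1 + l) <= expR (1 * l) by near: l; exact: expR_dominates.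
have l0 : 0 < l by lra.
have N0 : 0 < n%:R :> R by rewrite ltr0n.
have d1 : 0 < 1 - d by lra.
pose q (h : 'I_m0) (i : 'I_k) : nat := Num.truncn (2 * (1 - d) * x h i * l / g h).
have q_sum h : (\sum_i q h i <= c)%N.
  rewrite -(ler_nat R) natr_sum; apply: le_trans Cl; rewrite mulr_suml.
  apply: (@le_trans _ _ ((\sum_i 2 * x h i / g h) * l)).
    rewrite mulr_suml; apply: ler_sum => i _.
    have xl : 0 <= x h i * l / g h by rewrite divr_ge0 ?(ltW (g0 h))// mulr_ge0// ltW.
    apply: (@le_trans _ _ (2 * (1 - d) * x h i * l / g h)).
      rewrite truncn_le divr_ge0 ?(ltW (g0 h))// !mulr_ge0// ltW//.
    rewrite (_ : 2 * x h i / g h * l = 2 * (x h i * l / g h)); last by ring.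
    rewrite (_ : 2 * (1 - d) * x h i * l / g h = 2 * (1 - d) * (x h i * l / g h)); last by ring.
    by rewrite ler_wpM2r//; lra.
  rewrite (bigD1 h)//= lerDl sumr_ge0// => h' _.
  rewrite mulr_ge0 ?(ltW l0)// sumr_ge0// => i _.
  by rewrite divr_ge0 ?(ltW (g0 h'))// mulr_ge0.
have x_large h i : x h i != 0 -> (1 + d) / d <= 2 * (1 - d) * x h i * l / g h.
  move=> xN0; have xp : 0 < x h i by rewrite lt_def xN0 x0.
  have tB : (1 + d) / d * g h / (2 * (1 - d) * x h i) <= l.
    apply: le_trans lB; rewrite /B (bigD1 h)//= (bigD1 i)//= -addrA lerDl.
    by rewrite addr_ge0 ?sumr_ge0// => h' _; rewrite sumr_ge0.
  have dx : 0 < 2 * (1 - d) * x h i by rewrite !mulr_gt0.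
  by rewrite ler_pdivlMr// mulrC [leRHS]mulrC -ler_pdivrMr// mulrC.
have pv := violating_prob t a_ge0 d nE.
have pp := profiles_prob t n_gt0 a_ge0 a_sym aL x0 g0 sx d41 l0 nE b0 c0 q_sum num.
have pr01 z : 0 <= edge_prob a t z <= 1 by have /andP[-> /ltW] := edge_prob01 t a_ge0 z.
rewrite lerBlDr -[leLHS](Ex_cst (edge_prob a t)).
apply: (@le_trans _ _ (Ex (edge_prob a t) (fun u => (within_eps F eps u)%:R
    + ((violating a t d l u)%:R + (~~ all_profiles t x g d l b c u)%:R)))).
  apply: ler_Ex => // u.
  have [_|nv] := boolP (violating a t d l u).
    by rewrite -[leLHS]add0r lerD// lerDl.
  have [ap|_] := boolP (all_profiles t x g d l b c u); last first.
    by rewrite /= !add0r -[leLHS]add0r lerD.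
  rewrite /= !addr0 ler1n lt0b /within_eps lnE.
  set m := chromatic_number _.
  have mcol : conf_colorable u m.
    by apply/conf_colorable_graph; exact: chromatic_number_colorable.
  have low := not_violating_colours a_sym aL L_ge0 F_lower d41 l0 bal nv mcol.
  have up := all_profiles_colours x0 g0 xs d41 l0 b0 c0 x_large bal ap.
  have {up} : (m <= \sum_h (Num.truncn ((1 + d) ^+ 2 * n%:R * g h / (2 * (1 - d) * l))).+1
       + k * (b * c))%N.
    by apply: chromatic_number_le; apply/conf_colorable_graph; exact: up.
  rewrite -(ler_nat R) natrD natr_sum natrM => up.
  rewrite ler_norml; apply/andP; split.
    rewrite lerBrDr addrC; apply: (@lower_numeric R F eps d l n%:R L m%:R) => //.
    by rewrite mulrC -ler_pdivrMr// mulr_gt0.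
  rewrite lerBlDr addrC; apply: (@upper_numeric R F eps d l n%:R m%:R (k%:R * (b * c)%:R) m0 g) => //.
  - have := ler_wpM2r (ltW eps0) m0l; rewrite mul1r -nE.
    have -> : 8 * m0%:R / eps * (1 + l) * eps = 8 * m0%:R * (1 + l).
      by field; rewrite gt_eqF.
    have : 0 <= m0%:R :> R by rewrite ler0n.
    lra.
  - by rewrite mulrA nE.
  - apply: le_trans up _; rewrite lerD2r; apply: ler_sum => h _.
    have l0' := ltW l0; have d0' := ltW d0; have d1' := ltW d1; have gh := ltW (g0 h).
    have d2 : 0 <= 1 + d by rewrite addr_ge0.
    by rewrite -natr1 lerD2r truncn_le divr_ge0 ?mulr_ge0// exprn_ge0.
have ExD f1 f2 : Ex (edge_prob a t) (fun u => f1 u + f2 u) =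
    Ex (edge_prob a t) f1 + Ex (edge_prob a t) f2.
  by rewrite /Ex -big_split; apply: eq_bigr => u _; rewrite mulrDr.
rewrite !ExD lerD2l; apply: le_trans (lerD pv pp) _.
apply: le_trans (lerD viol tail) _; lra.
Unshelve. all: by end_near. Qed.

End Concentration.

(** * Averaging over the types *)

Section Average.
Variables (R : realType) (k : nat) (a : 'I_k -> 'I_k -> R).
Hypothesis a_ge0 : forall i j, 0 <= a i j.
Variables (s : 'I_k -> R) (F : R).
Hypothesis s_ge0 : forall i, 0 <= s i.
Hypothesis s_sum : \sum_i s i = 1.

Definition success (eps : R) (n : nat) : R :=
  \sum_(t : {ffun 'I_n -> 'I_k}) type_prob s t *
    Ex (edge_prob a t) (fun u => (within_eps F eps u)%:R).

Let pr01 n (t : 'I_n -> 'I_k) z : 0 <= edge_prob a t z <= 1.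
Proof. by have /andP[-> /ltW] := edge_prob01 t a_ge0 z. Qed.

Lemma success_le1 eps n : success eps n <= 1.
Proof.
rewrite -[leRHS](sum_type_prob n s_sum); apply: ler_sum => t _.
rewrite ler_piMr ?type_prob_ge0// -[leRHS](Ex_cst (edge_prob a t)).
by apply: ler_Ex => // u; rewrite lern1 leq_b1.
Qed.

(** Unbalanced types are discarded by Chebyshev's inequality, at a cost of order [1 / n], written
    [expR (- ln n)] to match [expRN_small]. Null blocks contribute 0 through the convention for
    inverses. *)
Lemma success_ge eps e d n : 0 < e -> 0 < d -> (0 < n)%N ->
  concentrated a s F eps e d (ln n%:R) ->
  1 - (e + (\sum_i (d ^+ 2 * s i)^-1) * expR (- ln n%:R)) <= success eps n.
Proof.
move=> e0 d0 n0 conc; have N0 : 0 < n%:R :> R by rewrite ltr0n.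
have nE : n%:R = expR (ln n%:R) :> R by rewrite lnK ?posrE.
pose bal (t : {ffun 'I_n -> 'I_k}) :=
  [forall i, `|occupancy R t i - n%:R * s i| <= d * (n%:R * s i)].
pose G t := Ex (edge_prob a t) (fun u : {ffun 'I_n * 'I_n -> bool} => (within_eps F eps u)%:R : R).
have G01 t : 0 <= G t by apply: Ex_ge0 => // u; rewrite ler0n.
have tp0 (t : {ffun 'I_n -> 'I_k}) : 0 <= type_prob s t by exact: type_prob_ge0.
have unbal : \sum_(t | ~~ bal t) type_prob s t <=
    (\sum_i (d ^+ 2 * s i)^-1) * expR (- ln n%:R).
  rewrite expRN -nE mulr_suml.
  apply: (@le_trans _ _ (\sum_i \sum_(t : {ffun 'I_n -> 'I_k} |
      d * (n%:R * s i) < `|occupancy R t i - n%:R * s i|) type_prob s t)).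
    under [leRHS]eq_bigr do rewrite big_mkcond.
    rewrite exchange_big /= big_mkcond; apply: ler_sum => t _.
    case: ifP => [|_]; last by rewrite sumr_ge0// => i _; case: ifP.
    rewrite negb_forall => /existsP[i]; rewrite -ltNge => lt_i.
    by rewrite (bigD1 i)//= lt_i lerDl sumr_ge0// => j _; case: ifP.
  apply: ler_sum => i _; apply: le_trans (occupancy_tail _ s_ge0 s_sum _ d0) _.
  by rewrite -invfM mulrAC.
rewrite lerBlDr -[leLHS](sum_type_prob n s_sum) [leLHS](bigID bal) /=.
rewrite addrA; apply: lerD => //.
rewrite /success [X in _ <= X + _](bigID bal) /=.
apply: (@le_trans _ _ (\sum_(t | bal t) (type_prob s t * G t + type_prob s t * e))).
  apply: ler_sum => t /forallP bt; rewrite -mulrDr ler_peMr//.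
  by rewrite -lerBlDr; apply: conc => // i; rewrite -occupancy_type_count.
rewrite big_split /= -addrA lerD2l -mulr_suml.
rewrite -[leLHS]add0r lerD//.
  by apply: sumr_ge0 => t _; rewrite mulr_ge0 ?tp0//; exact: G01.
rewrite ler_piMl ?(ltW e0)// -[leRHS](sum_type_prob n s_sum) [leRHS](bigID bal)/=.
by rewrite lerDl sumr_ge0.
Qed.

End Average.

Theorem theorem2p6 (R : realType) (k : nat) (W : R -> R -> R)
    (W_block : block_graphon k W)
    (W_lt1 : {in `[0, 1] &, forall x y, W x y < 1})
    (d : nat -> measure_display) (Omega : forall n, measurableType (d n))
    (P : forall n, probability (Omega n) R)
    (G : forall n, Omega n -> simple_graph 'I_n)
    (G_law : forall n, graphon_random_graph (P n) W (G n))
    (eps : R) (eps_gt0 : 0 < eps) :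
  P n [set w | (`|((chromatic_number (G n w))%:R * (2 * ln n%:R / n%:R))%:E
                  - varphi_k k W| <= eps%:E)%E] @[n --> \oo] --> 1%E.
Proof.
have [S [a [L [[S_meas S_cover] S_triv [a_ge0 a_sym] WE [aL L_ge0 k_gt0]]]]] :=
  block_graphon_data W_block W_lt1.
pose s := block_size S; pose F := fine (varphi_k k W).
have s_ge0 i : 0 <= s i by exact: block_size_ge0.
have s_sum : \sum_i s i = 1 by exact: sum_block_size.
have sE i : (s i)%:E = unif01 R (S i) by exact: block_sizeE.
have FE : varphi_k k W = F%:E := varphi_k_fin S_meas S_cover S_triv a_ge0 WE aL k_gt0.
have F_lower := varphi_k_lower S_meas S_cover S_triv a_ge0 WE aL k_gt0.
have F_upper := varphi_k_ge S_meas S_cover S_triv a_ge0 WE aL k_gt0.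
(* The spaces [Omega n] are unrelated for different [n]; after this step only the real sequence
   [success] is left. *)
have PE n : P n [set w | (`|((chromatic_number (G n w))%:R * (2 * ln n%:R / n%:R))%:E
    - varphi_k k W| <= eps%:E)%E] = (success a s F eps n)%:E.
  have [adj_meas [X X_unif X_law]] := G_law n.
  rewrite -(prob_conf S_meas S_cover S_triv WE k_gt0 sE adj_meas X_unif X_law
    (fun _ u => within_eps F eps u)).
  congr (P n _); apply/seteqP; split => w /=;
    by rewrite /within_eps -chromatic_number_conf FE -EFinB abse_EFin lee_fin.
rewrite (_ : (fun n => P n _) = EFin \o success a s F eps); last exact/funext.
apply: cvg_EFin; first exact: nearW.
apply/cvgrPdist_le => e e0.
have e2 : 0 < e / 2 by rewrite divr_gt0.
have [h h0 conc] := fixed_types_concentration a_ge0 a_sym aL L_ge0 F_lower F_upper eps_gt0 e2.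
have small := expRN_small (\sum_i (h ^+ 2 * s i)^-1) e2.
near=> n.
have n0 : (0 < n)%N by near: n; exact: nbhs_infty_gt.
have nconc : concentrated a s F eps (e / 2) h (ln n%:R).
  by near: n; exact: (ln_nat_cvg conc).
have nsmall : (\sum_i (h ^+ 2 * s i)^-1) * expR (- ln n%:R) <= e / 2.
  by near: n; exact: (ln_nat_cvg small).
have := success_ge a_ge0 s_ge0 s_sum e2 h0 n0 nconc.
have := success_le1 a_ge0 F s_ge0 s_sum eps n.
move=> le1 ge1; rewrite /= ger0_norm ?subr_ge0//; lra.
Unshelve. all: by end_near. Qed.
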